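(* Let $a, b \in \mathbb{C}\setminus\{0\}$, $c>0$, $|a|\ne1$, $|b|\ne1,2$, and $c>\max\{|a|+1,|a|+|b|-1\}$. Let $0<\lambda\le1$ and $0\le\beta<1$, and assume that $$\frac{\Gamma(c)\,\Gamma(c-|a|-|b|)}{\Gamma(c-|a|)\,\Gamma(c-|b|)}\left[\frac{(\lambda-1)(c-|a|-|b|)(c-|a|-1)}{(|a|-1)(|b|-1)(|b|-2)}\;{}_2F_1(|a|-1,|b|-2;c-|a|-1;-1)+{}_2F_1(|a|,|b|;c-|a|;-1)\right]$$ $$\le \lambda\left(1+\frac1{2(1-\beta)}\right)+\frac{(\lambda-1)(c-1)(c-2)}{(|a|-1)(|b|-1)(|b|-2)}.$$ Then the integral operator $\mathcal{I}^{a,\frac b2,\frac{b+1}2}_{\frac c2,\frac{c+1}2}$ maps $\mathcal{R}(\beta)$ into $\mathcal{S}^*_\lambda$.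
   Context: $\mathbb{D}=\{z\in\mathbb{C}:|z|<1\}$. $\mathcal{A}$ is the family of analytic functions $f$ on $\mathbb{D}$ of the form $f(z)=z+\sum_{n\ge2}a_nz^n$. For $\lambda>0$, $\mathcal{S}^*_\lambda=\{f\in\mathcal{A}: |zf'(z)/f(z)-1|<\lambda,\ z\in\mathbb{D}\}$. For $\beta<1$, $\mathcal{R}(\beta)$ is the set of $f\in\mathcal{A}$ for which there exists $\phi\in\mathbb{R}$ with $\operatorname{Re}\left(e^{i\phi}(f'(z)-\beta)\right)>0$ for all $z\in\mathbb{D}$. Pochhammer symbol: $(x)_0=1$, $(x)_n=x(x+1)\cdots(x+n-1)$ for $n\ge1$. Clausen's hypergeometric function is ${}_3F_2(a,b,c;d,e;z)=\sum_{n=0}^\infty\frac{(a)_n(b)_n(c)_n}{(d)_n(e)_n(1)_n}z^n$ for $|z|<1$, with $d,e\ne0,-1,-2,\dots$. The integral operator is defined for $f(z)=z+\sum_{n\ge2}a_nz^n\in\mathcal{A}$ by the convolution (coefficientwise product) $$\mathcal{I}^{a,\frac b2,\frac{b+1}2}_{\frac c2,\frac{c+1}2}(f)(z)=z\,{}_3F_2\left(a,\tfrac b2,\tfrac{b+1}2;\tfrac c2,\tfrac{c+1}2;z\right)*f(z)=z+\sum_{n=2}^\infty\frac{(a)_{n-1}\left(\frac b2\right)_{n-1}\left(\frac{b+1}2\right)_{n-1}}{\left(\frac c2\right)_{n-1}\left(\frac{c+1}2\right)_{n-1}(1)_{n-1}}\,a_nz^n.$$ ${}_2F_1(a,b;c;z)$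 is the Gauss hypergeometric function, i.e. $\sum_{n\ge0}\frac{(a)_n(b)_n}{(c)_n(1)_n}z^n$ for $|z|<1$, continued analytically to $\mathbb{C}\setminus[1,\infty)$ (so its value at $-1$ makes sense).
   Formalization: The formal theorem additionally assumes c > |a|+|b|; for |a|+|b|-1 < c < |a|+|b| the claim fails (e.g. a=3/2, b=9/5, c=14/5, λ=1, β=0), and at c = |a|+|b| the factor Γ(c-|a|-|b|) is undefined. *)

(* Defs.v *)
From Stdlib Require Import Reals.
From Coquelicot Require Import Coquelicot.

Open Scope R_scope.

Definition unit_disk (z : C) : Prop := Cmod z < 1.

Definition expands_as (f : C -> C) (u : nat -> C) : Prop :=
  forall z : C, unit_disk z -> is_pseries u z (f z).

(* Functions on the disk are represented by total functions C -> C, whose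
   values outside the disk are never used. *)
Definition class_A (f : C -> C) : Prop :=
  (forall z : C, unit_disk z -> ex_derive f z) /\
  exists u : nat -> C, u 0%nat = 0 /\ u 1%nat = 1 /\ expands_as f u.

(* At z = 0 the quotient z f'(z) / f(z) has a removable singularity with value
   1, so the inequality is trivial there; since x / 0 is a junk value in Rocq,
   the origin is left out and f z <> 0 is required elsewhere. *)
Definition starlike (lambda : R) (f : C -> C) : Prop :=
  class_A f /\
  forall z : C, unit_disk z -> z <> 0 ->
    f z <> 0 /\ Cmod (z * C_derive f z / f z - 1)%C < lambda.

(* The pair (cos phi, sin phi) is exp (i phi). *)
Definition class_R (beta : R) (f : C -> C) : Prop :=
  class_A f /\
  exists phi : R, forall z : C, unit_disk z ->
    0 < Re ((cos phi, sin phi) * (C_derive f z - beta))%C.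

Fixpoint pochhammer (x : C) (n : nat) : C :=
  match n with
  | O => 1
  | S m => (pochhammer x m * (x + INR m))%C
  end.

Definition clausen_coeff (a b c d e : C) (n : nat) : C :=
  (pochhammer a n * pochhammer b n * pochhammer c n /
   (pochhammer d n * pochhammer e n * pochhammer 1 n))%C.

(* Coefficients of z 3F2(a,b,c;d,e;z). *)
Definition shifted_clausen_coeff (a b c d e : C) (n : nat) : C :=
  match n with
  | O => 0
  | S m => clausen_coeff a b c d e m
  end.

(* The graph of the operator f |-> z 3F2(a,b,c;d,e;z) * f, where * is the
   coefficientwise product.  It determines g on the disk. *)
Definition clausen_operator (a b c d e : C) (f g : C -> C) : Prop :=
  exists u : nat -> C,
    expands_as f u /\
    expands_as g (fun n => (shifted_clausen_coeff a b c d e n * u n)%C).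

Definition maps_into (T : (C -> C) -> (C -> C) -> Prop)
    (P Q : (C -> C) -> Prop) : Prop :=
  forall f : C -> C, P f ->
    (exists g : C -> C, T f g) /\ (forall g : C -> C, T f g -> Q g).

Definition gauss_coeff (a b c : C) (n : nat) : C :=
  (pochhammer a n * pochhammer b n /
   (pochhammer c n * pochhammer 1 n))%C.

Definition slit_plane (z : C) : Prop := ~ (Im z = 0 /\ 1 <= Re z).

(* F is the (unique) analytic continuation of the Gauss series to the plane
   cut along [1, +oo). *)
Definition is_2F1 (a b c : C) (F : C -> C) : Prop :=
  expands_as F (gauss_coeff a b c) /\
  (forall z : C, slit_plane z -> ex_derive F z).

(* Euler's integral; it converges only for x > 0. *)
Definition Gamma (x : R) : R :=
  RInt_gen (fun t => Rpower t (x - 1) * exp (- t))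
    (at_right 0) (Rbar_locally p_infty).

(* Main.v *)
(* A function f = z + sum u_n z^n of R(beta) satisfies n |u_n| <= 2 (1 - beta)
   (Caratheodory), and z + sum b_n z^n is in S*_lambda as soon as
   sum (n - 1 + lambda) |b_n| <= lambda.  With A = |a|, B = |b| and
   T_n = (A)_n (B)_2n / ((c)_2n n!) >= |coefficient of the operator|, it
   suffices that sum (1 + (lambda - 1) / (n + 1)) T_n is at most
   lambda (1 + 1 / (2 (1 - beta))).

   The sums of T_n and of T_n / (n + 1) are values of 2F1 at -1.  Write W_n for
   (B)_n / (c)_n and e_n for (A)_n / n!, the coefficients of (1 - x)^(-A).  For
   0 <= r < 1, apply the linear functional x^n |-> W_n to
     (1 - x)^(-A) (1 + r x)^(-A) = (1 - x (1 - r + r x))^(-A).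
   Expanding (1 + r x)^(-A) first, Gauss's theorem turns the left side into
   Gamma(c) Gamma(c-A-B) / (Gamma(c-A) Gamma(c-B)) 2F1(A, B; c-A; -r).
   Expanding the right side in powers of x (1 - r + r x), the m-th term is e_m
   times an average of W_m, ..., W_2m, so that dominated convergence gives
   sum e_m W_2m as r -> 1.  The second sum is the same identity for
   (A - 1, B - 2, c - 2).  All this only uses the values of the continued 2F1
   on (-1, 0] and its continuity at -1. *)

Require Import Defs.
From Stdlib Require Import Reals Factorial Lra Lia.
From Coquelicot Require Import Coquelicot.
Open Scope R_scope.

(** * Dominated convergence and rearrangement of series *)

(** The limit r -> 1 is forced: at -1 itself the Gauss series of parameters A, B, c - A may diverge,
    so the continued function is reached from inside the disk, while the majorant on the other side
    of the identity does not depend on r.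

    Gauss's theorem is proved for positive A and B. In the lowered triple, A - 1 and B - 2 may be
    negative and c - 2 may vanish; its sum at 1 is therefore derived from that of (A, B, c) by
    contiguity relations, with weights scaled by (c - 1) (c - 2) so that no denominator is left. The
    term of index 0 of the scaled series is the source of the summand with (c - 1) (c - 2) in the
    hypothesis, and dividing by (A - 1) (B - 1) (B - 2) is where the values 1 and 2 are excluded.

    In Gauss's theorem the behaviour of the Gamma quotient for large c comes from an integral
    inequality of Chebyshev type, which takes the place of Stirling's formula. Caratheodory's bound
    is proved by averaging over roots of unity, so that finite sums take the place of integrals over
    circles. The rotation by phi can only lower that bound, because Re (exp (i phi) (1 - beta)) <= 1
    - beta. *)

Lemma is_lim_seq_inv_INR (x : R) :
  0 <= x -> is_lim_seq (fun n => / (x + INR n)) 0.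
Proof.
intros Hx; replace (Finite 0) with (Rbar_inv p_infty) by reflexivity.
apply is_lim_seq_inv; [|easy].
apply is_lim_seq_le_p_loc with INR; [|apply is_lim_seq_INR].
exists O; intros; lra.
Qed.

Lemma is_series_iff_lim (a : nat -> R) (l : R) :
  is_series a l <-> is_lim_seq (sum_f_R0 a) l.
Proof.
split; intros H.
- apply is_lim_seq_ext with (sum_n a); [intros n; apply sum_n_Reals | exact H].
- apply (is_lim_seq_ext (sum_f_R0 a) (sum_n a)) in H;
    [exact H | intros n; symmetry; apply sum_n_Reals].
Qed.

Lemma ex_series_bounded (a : nat -> R) (M : R) :
  (forall n, 0 <= a n) -> (forall n, sum_f_R0 a n <= M) -> ex_series a.
Proof.
intros Ha HM.
destruct (ex_finite_lim_seq_incr (sum_f_R0 a) M) as [l Hl].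
- intros n; rewrite tech5; specialize (Ha (S n)); lra.
- exact HM.
- exists l; apply is_series_iff_lim; exact Hl.
Qed.

Lemma sum_le_Series (a : nat -> R) (n : nat) :
  (forall n, 0 <= a n) -> ex_series a -> sum_f_R0 a n <= Series a.
Proof.
intros Ha [l Hl]; rewrite (is_series_unique _ _ Hl).
apply is_series_iff_lim in Hl.
apply (is_lim_seq_incr_compare _ _ Hl).
intros m; rewrite tech5; specialize (Ha (S m)); lra.
Qed.

Lemma Series_finite (a : nat -> R) (n : nat) :
  (forall k, (n < k)%nat -> a k = 0) -> is_series a (sum_f_R0 a n).
Proof.
intros H; apply is_series_iff_lim.
apply (is_lim_seq_ext_loc (fun _ => sum_f_R0 a n)); [|apply is_lim_seq_const].
exists n; intros m Hm; induction Hm as [|m Hm IH]; [easy|].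
rewrite tech5, <- IH, H by lia; ring.
Qed.

Lemma Series_split (a : nat -> R) (n : nat) : ex_series a ->
  Series a = sum_f_R0 a n + Series (fun k => a (S n + k)%nat).
Proof. intros H; apply (Series_incr_n a (S n)); [lia | exact H]. Qed.

Lemma ex_series_dominated (a M : nat -> R) :
  (forall n, Rabs (a n) <= M n) -> ex_series M -> ex_series a.
Proof. intros H; apply (ex_series_le a M); exact H. Qed.

Lemma Series_dominated (a M : nat -> R) :
  (forall n, Rabs (a n) <= M n) -> ex_series M -> Rabs (Series a) <= Series M.
Proof.
intros H HM.
apply Rle_trans with (Series (fun n => Rabs (a n))).
- apply Series_Rabs. apply (ex_series_dominated _ M); [|exact HM].
  intros n; rewrite Rabs_Rabsolu; apply H.
- apply Series_le; [|exact HM]. intros n; split; [apply Rabs_pos | apply H].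
Qed.

Lemma is_lim_seq_sum (a : nat -> nat -> R) (l : nat -> R) (N : nat) :
  (forall k, is_lim_seq (fun n => a n k) (l k)) ->
  is_lim_seq (fun n => sum_f_R0 (a n) N) (sum_f_R0 l N).
Proof.
intros H; induction N as [|N IH]; simpl; [apply H|].
apply (is_lim_seq_plus' _ _ _ _ IH (H (S N))).
Qed.

(** Dominated convergence for series. Cut where the tail of [M] is below eps / 3: the finite head
    converges term by term, and the two tails cost at most eps / 3 each. *)
Lemma Tannery (a : nat -> nat -> R) (l M : nat -> R) :
  (forall n k, Rabs (a n k) <= M k) -> ex_series M ->
  (forall k, is_lim_seq (fun n => a n k) (l k)) ->
  is_lim_seq (fun n => Series (a n)) (Series l).
Proof.
intros Ha HM Hl.
assert (HlM : forall k, Rabs (l k) <= M k).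
{ intros k. apply (is_lim_seq_le (fun n => Rabs (a n k)) (fun _ => M k)
    (Rabs (l k)) (M k)).
  - intros n; apply Ha.
  - apply (is_lim_seq_abs _ (l k)), Hl.
  - apply is_lim_seq_const. }
apply is_lim_seq_spec; intros eps.
assert (He : 0 < eps / 3) by (destruct eps; simpl; lra).
destruct HM as [S HS].
assert (HM : ex_series M) by (exists S; exact HS).
pose proof (proj1 (is_series_iff_lim _ _) HS) as HS'.
apply is_lim_seq_spec in HS'.
destruct (HS' (mkposreal _ He)) as [N HN].
specialize (HN N (Nat.le_refl N)); simpl in HN.
pose proof (is_lim_seq_sum a l N Hl) as HF.
apply is_lim_seq_spec in HF.
destruct (HF (mkposreal _ He)) as [n0 Hn0].
exists n0; intros n Hn; specialize (Hn0 n Hn); simpl in Hn0.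
assert (HT : ex_series (fun k => M (Datatypes.S N + k)%nat))
  by (apply (ex_series_incr_n M), HM).
assert (Ht : Series (fun k => M (Datatypes.S N + k)%nat) < eps / 3).
{ pose proof (Series_split M N HM) as E.
  rewrite (is_series_unique _ _ HS) in E.
  apply Rabs_def2 in HN; lra. }
rewrite (Series_split (a n) N) by (apply (ex_series_dominated _ M); auto).
rewrite (Series_split l N) by (apply (ex_series_dominated _ M); auto).
pose proof (Series_dominated (fun k => a n (Datatypes.S N + k)%nat)
  (fun k => M (Datatypes.S N + k)%nat) (fun k => Ha n _) HT) as H1.
pose proof (Series_dominated (fun k => l (Datatypes.S N + k)%nat)
  (fun k => M (Datatypes.S N + k)%nat) (fun k => HlM _) HT) as H2.
apply Rabs_def2 in Hn0.
apply Rabs_le_between in H1. apply Rabs_le_between in H2.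
apply Rabs_def1; lra.
Qed.

Lemma sum_triangle (a : nat -> nat -> R) (N : nat) :
  sum_f_R0 (fun n => sum_f_R0 (fun k => a k (n - k)%nat) n) N =
  sum_f_R0 (fun k => sum_f_R0 (a k) (N - k)) N.
Proof.
induction N as [|N IH]; [reflexivity|].
rewrite !tech5, IH, Nat.sub_diag. simpl (sum_f_R0 (a (S N)) 0).
rewrite <- Rplus_assoc, <- plus_sum. f_equal.
apply sum_eq; intros k Hk.
replace (S N - k)%nat with (S (N - k)) by lia. rewrite tech5; reflexivity.
Qed.

(** The array cut off beyond the N-th antidiagonal ([t N]) has the N-th partial sum as its iterated
    sum. [Tannery], applied to the inner sums and then to the outer one, removes the cut. *)
Lemma series_antidiagonal (a : nat -> nat -> R) :
  (forall k, ex_series (fun j => Rabs (a k j))) ->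
  ex_series (fun k => Series (fun j => Rabs (a k j))) ->
  is_series (fun n => sum_f_R0 (fun k => a k (n - k)%nat) n)
    (Series (fun k => Series (a k))).
Proof.
intros H1 H2; apply is_series_iff_lim.
set (t := fun N k j => if (k + j <=? N)%nat then a k j else 0).
apply is_lim_seq_ext with (fun N => Series (fun k => Series (t N k))).
{ intros N. rewrite sum_triangle.
  assert (E : forall k, (k <= N)%nat ->
      Series (t N k) = sum_f_R0 (a k) (N - k)).
  { intros k Hk. erewrite is_series_unique;
      [|apply (Series_finite _ (N - k))].
    - apply sum_eq; intros j Hj; unfold t.
      now rewrite (proj2 (Nat.leb_le _ _)) by lia.
    - intros j Hj; unfold t.
      now rewrite (proj2 (Nat.leb_gt _ _)) by lia. }
  erewrite is_series_unique; [|apply (Series_finite _ N)].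
  - apply sum_eq; intros k Hk; apply E; exact Hk.
  (* The zero series is given the terms [0 * 0] so that [Series_scal_l] evaluates it. *)
  - intros k Hk. rewrite (Series_ext _ (fun _ => 0 * 0)).
    + rewrite (Series_scal_l 0); ring.
    + intros j; unfold t. rewrite (proj2 (Nat.leb_gt _ _)) by lia; ring. }
assert (Ht : forall N k j, Rabs (t N k j) <= Rabs (a k j)).
{ intros N k j; unfold t; destruct (_ <=? _)%nat; [lra|].
  rewrite Rabs_R0; apply Rabs_pos. }
apply (Tannery _ _ (fun k => Series (fun j => Rabs (a k j)))); [|exact H2|].
- intros N k. apply Series_dominated; auto.
- intros k. apply (Tannery _ _ (fun j => Rabs (a k j))); auto.
  intros j. apply (is_lim_seq_ext_loc (fun _ => a k j));
    [|apply is_lim_seq_const].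
  exists (k + j)%nat; intros n Hn; unfold t.
  now rewrite (proj2 (Nat.leb_le _ _)) by lia.
Qed.

(** This and the next two facts are library results restated with real multiplication and equality
    in place of the module operations, which keeps unification predictable. *)
Lemma ex_series_Rmult (c : R) (a : nat -> R) :
  ex_series a -> ex_series (fun n => c * a n).
Proof. exact (ex_series_scal_l c a). Qed.

Lemma is_series_Rext (a b : nat -> R) (l : R) :
  (forall n, a n = b n) -> is_series a l -> is_series b l.
Proof. exact (is_series_ext a b l). Qed.

Lemma is_series_Rmult (c : R) (a : nat -> R) (l : R) :
  is_series a l -> is_series (fun n => c * a n) (c * l).
Proof. exact (is_series_scal_l c a l). Qed.

(** * Coefficients of (1 - x)^(-A) *)

Fixpoint rising (x : R) (n : nat) : R :=
  match n with
  | O => 1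
  | S m => rising x m * (x + INR m)
  end.

Definition negbin (x : R) (n : nat) : R := rising x n / INR (fact n).

Lemma negbin_0 (x : R) : negbin x 0 = 1.
Proof. unfold negbin; simpl; field. Qed.

Lemma negbin_S (x : R) (n : nat) :
  INR (S n) * negbin x (S n) = (x + INR n) * negbin x n.
Proof.
unfold negbin; rewrite fact_simpl, mult_INR; simpl rising.
field; split; [apply INR_fact_neq_0 | apply not_0_INR; lia].
Qed.

Definition antidiag (g : nat -> nat -> R) (n : nat) : R :=
  sum_f_R0 (fun k => g k (n - k)%nat) n.

Lemma antidiag_ext (g h : nat -> nat -> R) (n : nat) :
  (forall k j, (k + j = n)%nat -> g k j = h k j) ->
  antidiag g n = antidiag h n.
Proof. intros H; apply sum_eq; intros k Hk; apply H; lia. Qed.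

Lemma antidiag_plus (g h : nat -> nat -> R) (n : nat) :
  antidiag (fun k j => g k j + h k j) n = antidiag g n + antidiag h n.
Proof. apply plus_sum. Qed.

Lemma antidiag_scal (x : R) (g : nat -> nat -> R) (n : nat) :
  antidiag (fun k j => x * g k j) n = x * antidiag g n.
Proof.
unfold antidiag; rewrite scal_sum; apply sum_eq; intros; ring.
Qed.

Lemma antidiag_shift_l (g : nat -> nat -> R) (n : nat) :
  g O (S n) = 0 -> antidiag g (S n) = antidiag (fun k j => g (S k) j) n.
Proof.
intros H; unfold antidiag; rewrite decomp_sum by lia; simpl pred.
replace (S n - 0)%nat with (S n) by lia. rewrite H, Rplus_0_l.
apply sum_eq; intros k Hk; f_equal; lia.
Qed.

Lemma antidiag_shift_r (g : nat -> nat -> R) (n : nat) :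
  g (S n) O = 0 -> antidiag g (S n) = antidiag (fun k j => g k (S j)) n.
Proof.
intros H; unfold antidiag; rewrite tech5, Nat.sub_diag, H, Rplus_0_r.
apply sum_eq; intros k Hk; f_equal; lia.
Qed.

(** Leibniz's rule for x d/dx: the total degree n is k + j. *)
Lemma antidiag_degree (g : nat -> nat -> R) (n : nat) :
  antidiag (fun k j => INR k * g k j) n + antidiag (fun k j => INR j * g k j) n
  = INR n * antidiag g n.
Proof.
rewrite <- antidiag_plus, <- antidiag_scal; apply antidiag_ext.
intros k j <-; rewrite plus_INR; ring.
Qed.

(* The coefficient of x^i in (p + r x)^m. *)
Fixpoint bin_weight (p r : R) (m i : nat) : R :=
  match m, i with
  | O, O => 1
  | O, S _ => 0
  | S m', O => p * bin_weight p r m' O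
  | S m', S i' => p * bin_weight p r m' (S i') + r * bin_weight p r m' i'
  end.

Lemma bin_weight_out (p r : R) (m i : nat) :
  (m < i)%nat -> bin_weight p r m i = 0.
Proof.
revert i; induction m as [|m IH]; intros [|i] H; simpl; try lia; [easy|].
rewrite !IH by lia; ring.
Qed.

(** Compares the coefficients of x^i in the x-derivative of (p + r x)^(m + 1). *)
Lemma bin_weight_S_S (p r : R) (m i : nat) :
  INR (S i) * bin_weight p r (S m) (S i) = r * INR (S m) * bin_weight p r m i.
Proof.
revert i; induction m as [|m IH]; intros i.
- destruct i; simpl; ring.
- change (bin_weight p r (S (S m)) (S i)) with
    (p * bin_weight p r (S m) (S i) + r * bin_weight p r (S m) i).
  rewrite Rmult_plus_distr_l.
  replace (INR (S i) * (p * bin_weight p r (S m) (S i))) with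
    (p * (r * INR (S m) * bin_weight p r m i)) by (rewrite <- IH; ring).
  destruct i as [|i].
  + simpl bin_weight; rewrite !S_INR; simpl INR; ring.
  + replace (INR (S (S i)) * (r * bin_weight p r (S m) (S i))) with
      (r * (r * INR (S m) * bin_weight p r m i)
       + r * bin_weight p r (S m) (S i))
      by (rewrite <- IH, (S_INR (S i)); ring).
    rewrite (S_INR (S m)).
    change (bin_weight p r (S m) (S i)) with
      (p * bin_weight p r m (S i) + r * bin_weight p r m i). ring.
Qed.

(** The same with p d/dp: the coefficient of x^i in (p + r x)^(m + 1) is homogeneous of degree m + 1
    - i in p. *)
Lemma bin_weight_S_l (p r : R) (m i : nat) :
  (INR (S m) - INR i) * bin_weight p r (S m) i
  = p * INR (S m) * bin_weight p r m i.
Proof.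
destruct i as [|i].
- simpl bin_weight; simpl (INR 0); ring.
- rewrite Rmult_minus_distr_r, bin_weight_S_S. simpl bin_weight. ring.
Qed.

(* Both sides are the coefficients of (1 - x)^(-A) (1 + r x)^(-A), the right
   one because (1 - x) (1 + r x) = 1 - x (1 - r + r x); both satisfy the
   three-term recurrence given by the first-order differential equation of
   this function. *)
Lemma negbin_convolution (A r : R) (n : nat) :
  antidiag (fun k j => negbin A k * (- r) ^ k * negbin A j) n =
  antidiag (fun m i => negbin A m * bin_weight (1 - r) r m i) n.
Proof.
set (g := fun k j => negbin A k * (- r) ^ k * negbin A j).
set (D := fun m i => negbin A m * bin_weight (1 - r) r m i).
set (p := 1 - r) in *.
set (d := antidiag g). set (X := antidiag D).
(* Each of [J], [K], [Y], [Z] weights the terms by one exponent. [HJ], [HK], [HZ], [HY] express how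
   these sums move with the degree; eliminating them leaves the three-term recurrences [Hd] and
   [HX], which coincide. *)
set (J := antidiag (fun k j => INR j * g k j)).
set (K := antidiag (fun k j => INR k * g k j)).
set (Y := antidiag (fun m i => INR i * D m i)).
set (Z := antidiag (fun m i => INR m * D m i)).
assert (HJ : forall n, J (S n) = A * d n + J n).
{ intros q; unfold J, d; rewrite antidiag_shift_r by (simpl; ring).
  rewrite <- antidiag_scal, <- antidiag_plus; apply antidiag_ext.
  intros k j _; unfold g.
  transitivity (negbin A k * (- r) ^ k * (INR (S j) * negbin A (S j)));
    [ring | rewrite negbin_S; ring]. }
assert (HK : forall n, K (S n) = - r * (A * d n + K n)).
{ intros q; unfold K, d; rewrite antidiag_shift_l by (simpl; ring).
  rewrite <- antidiag_scal, <- antidiag_plus, <- antidiag_scal.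
  apply antidiag_ext; intros k j _; unfold g.
  transitivity (- r * (- r) ^ k * (INR (S k) * negbin A (S k)) * negbin A j);
    [simpl pow; ring | rewrite negbin_S; ring]. }
assert (HJK : forall n, K n + J n = INR n * d n)
  by (intros; apply antidiag_degree).
assert (HZY : forall n, Z n + Y n = INR n * X n)
  by (intros; apply antidiag_degree).
assert (HZ : forall n, Z (S n) - Y (S n) = p * (A * X n + Z n)).
{ intros q; unfold Z, Y, X.
  replace (antidiag (fun m i => INR m * D m i) (S q) -
    antidiag (fun m i => INR i * D m i) (S q)) with
    (antidiag (fun m i => (INR m - INR i) * D m i) (S q)).
  2:{ unfold Rminus; rewrite <- (Rmult_1_l (antidiag _ _)) at 1.
      replace (- antidiag (fun m i => INR i * D m i) (S q)) with
        (-1 * antidiag (fun m i => INR i * D m i) (S q)) by ring.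
      rewrite Rmult_1_l, <- antidiag_scal, <- antidiag_plus.
      apply antidiag_ext; intros; ring. }
  rewrite antidiag_shift_l by (unfold D; simpl; ring).
  rewrite <- antidiag_scal, <- antidiag_plus, <- antidiag_scal.
  apply antidiag_ext; intros m i _; unfold D.
  transitivity (negbin A (S m) *
    ((INR (S m) - INR i) * bin_weight p r (S m) i)); [ring|].
  rewrite bin_weight_S_l.
  transitivity (p * (INR (S m) * negbin A (S m)) * bin_weight p r m i);
    [ring | rewrite negbin_S; ring]. }
(* A nonzero term with i >= 1 also has m >= 1, so [HY] lowers both indices and starts only at degree
   2; degree 1 is settled here. *)
assert (HY1 : Y 1%nat = 0) by (unfold Y, D, antidiag; simpl; ring).
assert (HY : forall n, Y (S (S n)) = r * (A * X n + Z n)).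
{ intros q; unfold Z, Y, X.
  rewrite antidiag_shift_l by (unfold D; simpl; ring).
  rewrite antidiag_shift_r by (simpl; ring).
  rewrite <- antidiag_scal, <- antidiag_plus, <- antidiag_scal.
  apply antidiag_ext; intros m i _; unfold D.
  transitivity (negbin A (S m) *
    (INR (S i) * bin_weight p r (S m) (S i))); [ring|].
  rewrite bin_weight_S_S.
  transitivity (r * (INR (S m) * negbin A (S m)) * bin_weight p r m i);
    [ring | rewrite negbin_S; ring]. }
assert (Hd : forall n, INR (S (S n)) * d (S (S n)) =
    p * (INR (S n) + A) * d (S n) + r * (INR n + 2 * A) * d n).
{ intros q; rewrite <- HJK, HJ, HK.
  pose proof (HJK (S q)) as E1; pose proof (HJK q) as E2.
  assert (E3 : r * J (S q) - K (S q) = r * (INR q + 2 * A) * d q)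
    by (rewrite HJ, HK; transitivity (r * (K q + J q) + 2 * A * r * d q);
        [ring | rewrite E2; ring]).
  rewrite <- E3. replace (p * (INR (S q) + A) * d (S q)) with
    (p * (K (S q) + J (S q)) + p * A * d (S q)) by (rewrite E1; ring).
  unfold p; ring. }
assert (HX : forall n, INR (S (S n)) * X (S (S n)) =
    p * (INR (S n) + A) * X (S n) + r * (INR n + 2 * A) * X n).
{ intros q; rewrite <- HZY.
  pose proof (HZY (S q)) as E1; pose proof (HZY q) as E2.
  assert (E3 : r * (Z q - Y q) = p * Y (S q)).
  { destruct q as [|q]; [|rewrite HZ, HY; ring].
    rewrite HY1; unfold Z, Y, antidiag; simpl; ring. }
  pose proof (HZ (S q)) as E4; pose proof (HY q) as E5.
  replace (Z (S (S q)) + Y (S (S q))) with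
    (p * (A * X (S q) + Z (S q)) + 2 * (r * (A * X q + Z q))) by lra.
  replace (p * (INR (S q) + A) * X (S q)) with
    (p * (Z (S q) + Y (S q)) + p * A * X (S q)) by (rewrite E1; ring).
  replace (r * (INR q + 2 * A) * X q) with
    (r * (Z q + Y q) + 2 * A * r * X q) by (rewrite E2; ring).
  lra. }
assert (H0 : d O = X O) by (unfold d, X, g, D, antidiag; simpl; rewrite negbin_0; ring).
assert (H1 : d 1%nat = X 1%nat).
{ pose proof (HJK 1%nat) as E; rewrite HJ, HK in E.
  pose proof (HZY 1%nat) as E'; pose proof (HZ 0%nat) as E''.
  rewrite HY1 in *. rewrite <- H0 in E''.
  assert (K O = 0) by (unfold K, antidiag; simpl; ring).
  assert (J O = 0) by (unfold J, antidiag; simpl; ring).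
  assert (Z O = 0) by (unfold Z, antidiag; simpl; ring).
  simpl INR in *; unfold p in *; nra. }
change (d n = X n).
enough (d n = X n /\ d (S n) = X (S n)) by easy.
induction n as [|n [IH1 IH2]]; [easy|]; split; [easy|].
apply (Rmult_eq_reg_l (INR (S (S n)))); [|apply not_0_INR; lia].
rewrite Hd, HX, IH1, IH2; reflexivity.
Qed.

Lemma bin_weight_ge0 (p r : R) (m i : nat) :
  0 <= p -> 0 <= r -> 0 <= bin_weight p r m i.
Proof.
intros Hp Hr; revert i; induction m as [|m IH]; intros [|i]; simpl; try lra.
- apply Rmult_le_pos; auto.
- apply Rplus_le_le_0_compat; apply Rmult_le_pos; auto.
Qed.

(** The value of (p + r x)^m at x = 1. For p = 1 - r in [0, 1] the weights form a probability
    distribution on 0, ..., m. *)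
Lemma bin_weight_sum (p r : R) (m : nat) :
  sum_f_R0 (bin_weight p r m) m = (p + r) ^ m.
Proof.
induction m as [|m IH]; [reflexivity|].
rewrite decomp_sum by lia; simpl pred.
assert (E : sum_f_R0 (bin_weight p r m) (S m) = (p + r) ^ m)
  by (rewrite tech5, IH, bin_weight_out by lia; ring).
rewrite decomp_sum in E by lia; simpl pred in E.
simpl bin_weight; rewrite plus_sum.
replace (sum_f_R0 (fun l => p * bin_weight p r m (S l)) m) with
  (p * sum_f_R0 (fun i => bin_weight p r m (S i)) m)
  by (rewrite scal_sum; apply sum_eq; intros; ring).
replace (sum_f_R0 (fun l => r * bin_weight p r m l) m) with
  (r * (p + r) ^ m)
  by (rewrite <- IH, scal_sum; apply sum_eq; intros; ring).
replace ((p + r) ^ S m) with (p * (p + r) ^ m + r * (p + r) ^ m)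
  by (simpl; ring).
rewrite <- E; ring.
Qed.

(** In the limit the polynomial (p + r x)^m becomes x^m, so the average over W_m, ..., W_2m
    concentrates on W_2m. *)
Lemma bin_weight_lim (p r : nat -> R) (m i : nat) :
  is_lim_seq p 0 -> is_lim_seq r 1 ->
  is_lim_seq (fun n => bin_weight (p n) (r n) m i)
    (Finite (if (i =? m)%nat then 1 else 0)).
Proof.
intros Hp Hr; revert i; induction m as [|m IH]; intros [|i]; simpl.
- apply is_lim_seq_const.
- apply is_lim_seq_const.
- rewrite <- (Rmult_0_l (if (0 =? m)%nat then 1 else 0)).
  exact (is_lim_seq_mult' _ _ _ _ Hp (IH O)).
- replace (if (i =? m)%nat then 1 else 0) with
    (0 * (if (S i =? m)%nat then 1 else 0) +
     1 * (if (i =? m)%nat then 1 else 0)) by ring.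
  exact (is_lim_seq_plus' _ _ _ _ (is_lim_seq_mult' _ _ _ _ Hp (IH (S i)))
    (is_lim_seq_mult' _ _ _ _ Hr (IH i))).
Qed.

(** * Abel limits of Gauss series *)

Lemma rising_pos (x : R) (n : nat) : 0 < x -> 0 < rising x n.
Proof.
intros Hx; induction n as [|n IH]; simpl; [lra|].
apply Rmult_lt_0_compat; [exact IH|]. pose proof (pos_INR n); lra.
Qed.

Lemma rising_le (x y : R) (n : nat) :
  Rabs x <= y -> Rabs (rising x n) <= rising y n.
Proof.
intros H; induction n as [|n IH]; simpl; [rewrite Rabs_R1; lra|].
rewrite Rabs_mult. apply Rmult_le_compat; try apply Rabs_pos; [exact IH|].
apply Rle_trans with (Rabs x + Rabs (INR n)); [apply Rabs_triang|].
rewrite (Rabs_pos_eq (INR n)) by apply pos_INR. lra.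
Qed.

Lemma negbin_pos (x : R) (n : nat) : 0 < x -> 0 < negbin x n.
Proof.
intros Hx; apply Rdiv_lt_0_compat; [apply rising_pos, Hx|apply INR_fact_lt_0].
Qed.

Lemma negbin_le (x y : R) (n : nat) :
  Rabs x <= y -> Rabs (negbin x n) <= negbin y n.
Proof.
intros H; unfold negbin, Rdiv; rewrite Rabs_mult.
pose proof (Rinv_0_lt_compat _ (INR_fact_lt_0 n)).
rewrite (Rabs_pos_eq (/ _)) by lra.
apply Rmult_le_compat_r; [lra | apply rising_le, H].
Qed.

Lemma ex_series_negbin_pow (x r : R) :
  0 <= r < 1 -> ex_series (fun k => Rabs (negbin x k) * r ^ k).
Proof.
intros Hr.
(* The ratio test needs nonvanishing terms: [y] > 0 makes the majorant positive for every x, and [s]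
   lies strictly between r and 1, hence is positive even when r = 0. *)
set (y := Rabs x + 1). set (s := (r + 1) / 2).
assert (Hy : 0 < y) by (unfold y; pose proof (Rabs_pos x); lra).
assert (Hs : 0 < s) by (unfold s; lra).
assert (Ha : forall n, 0 < negbin y n * s ^ n)
  by (intros n; apply Rmult_lt_0_compat;
      [apply negbin_pos, Hy | apply pow_lt, Hs]).
apply ex_series_dominated with (fun k => Rabs (negbin y k * s ^ k)).
- intros n; rewrite Rabs_mult, Rabs_Rabsolu, (Rabs_pos_eq (_ * _))
    by apply Rlt_le, Ha.
  apply Rmult_le_compat; try apply Rabs_pos.
  + apply negbin_le; unfold y; lra.
  + rewrite Rabs_pos_eq by (apply pow_le; lra).
    apply pow_incr; unfold s; lra.
- apply ex_series_DAlembert with s; [unfold s; lra | |].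
  + intros n; apply Rgt_not_eq, Ha.
  + apply is_lim_seq_ext with (fun n => s + s * (y - 1) * / (1 + INR n)).
    { intros n. pose proof (negbin_S y n) as E.
      pose proof (lt_0_INR (S n) ltac:(lia)) as Hn.
      pose proof (negbin_pos y n Hy); pose proof (pow_lt s n Hs).
      rewrite Rabs_pos_eq
        by (apply Rlt_le, Rdiv_lt_0_compat; apply Ha).
      replace (negbin y (S n)) with ((y + INR n) * negbin y n / INR (S n))
        by (rewrite <- E; field; lra).
      rewrite S_INR in *; simpl pow; field; repeat split; lra. }
    replace s with (s + s * (y - 1) * 0) at 1 by ring.
    apply is_lim_seq_plus'; [apply is_lim_seq_const|].
    apply is_lim_seq_mult'; [apply is_lim_seq_const|].
    apply is_lim_seq_inv_INR; lra.
Qed.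

(* A weight sequence W behaving like n |-> (B)_n / (c)_n; allowing any
   solution of the recurrence covers c = 0, where the quotient makes no
   sense. *)
Definition hyper_weight (A B c : R) (W V : nat -> R) : Prop :=
  (forall n, (c + INR n) * W (S n) = (B + INR n) * W n) /\
  (forall n k, Rabs (W (n + k)%nat) <= V n) /\
  ex_series (fun j => Rabs (negbin A j) * V j) /\
  (forall k, is_lim_seq (fun j => INR j * negbin A j * W (j + k)%nat) 0).

(** The functional x^n |-> W_n applied to x^k (1 - x)^(-A). *)
Definition gauss_sum (A : R) (W : nat -> R) (k : nat) : R :=
  Series (fun j => negbin A j * W (j + k)%nat).

Lemma ex_gauss_sum (A B c : R) (W V : nat -> R) (k : nat) :
  hyper_weight A B c W V -> ex_series (fun j => negbin A j * W (j + k)%nat).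
Proof.
intros (_ & HV & Hs & _).
apply ex_series_dominated with (2 := Hs); intros j.
rewrite Rabs_mult; apply Rmult_le_compat_l; [apply Rabs_pos | apply HV].
Qed.

(** The termwise difference of the two sides telescopes: its n-th partial sum is (n + 1) e_(n+1)
    W_(n+1+k), which vanishes in the limit by the last clause of [hyper_weight]. *)
Lemma gauss_sum_S (A B c : R) (W V : nat -> R) (k : nat) :
  hyper_weight A B c W V ->
  (c - A + INR k) * gauss_sum A W (S k) = (B + INR k) * gauss_sum A W k.
Proof.
intros H; pose proof H as (HW & _ & _ & Hl).
assert (E : is_series (fun j => (B + INR k) * (negbin A j * W (j + k)%nat)
  - (c - A + INR k) * (negbin A j * W (j + S k)%nat)) 0).
{ apply is_series_iff_lim.
  apply is_lim_seq_ext with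
    (fun n => INR (S n) * negbin A (S n) * W (S n + k)%nat).
  - intros n; induction n as [|n IH].
    + rewrite negbin_S, negbin_0. simpl sum_f_R0; rewrite negbin_0.
      specialize (HW k); simpl INR; simpl Nat.add; lra.
    + rewrite tech5, <- IH. rewrite (negbin_S A (S n)).
      specialize (HW (S n + k)%nat); rewrite plus_INR in HW.
      replace (S n + S k)%nat with (S (S n + k)) by lia.
      replace (S (S n) + k)%nat with (S (S n + k)) by lia.
      replace ((B + INR k) * (negbin A (S n) * W (S n + k)%nat)) with
        (negbin A (S n) * ((B + (INR (S n) + INR k)) * W (S n + k)%nat)
         - INR (S n) * negbin A (S n) * W (S n + k)%nat) by ring.
      rewrite <- HW; ring.
  - apply (is_lim_seq_incr_1 (fun n => INR n * negbin A n * W (n + k)%nat)).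
    apply Hl. }
apply is_series_unique in E.
rewrite Series_minus, !Series_scal_l in E.
- unfold gauss_sum; lra.
- apply (ex_series_Rmult (B + INR k)), (ex_gauss_sum _ _ _ _ _ _ H).
- apply (ex_series_Rmult (c - A + INR k)), (ex_gauss_sum _ _ _ _ _ _ H).
Qed.

(** Iterating [gauss_sum_S] leaves one unknown, the sum at k = 0. This is where the lower parameter
    c - A of the resulting 2F1 comes from. *)
Lemma gauss_sum_eq (A B c : R) (W V : nat -> R) (k : nat) :
  hyper_weight A B c W V -> 0 < c - A ->
  gauss_sum A W k = gauss_sum A W 0 * (rising B k / rising (c - A) k).
Proof.
intros H HcA; induction k as [|k IH]; [simpl; field|].
pose proof (rising_pos _ k HcA). pose proof (pos_INR k).
apply (Rmult_eq_reg_l (c - A + INR k)); [|lra].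
rewrite (gauss_sum_S _ _ _ _ _ _ H), IH; simpl; field; lra.
Qed.

(** The functional x^n |-> W_n applied to x^m (1 - r + r x)^m. *)
Definition thinned (W : nat -> R) (r : R) (m : nat) : R :=
  sum_f_R0 (fun i => bin_weight (1 - r) r m i * W (m + i)%nat) m.

(** The arrays [a] and [b] come from the two factorizations of the same function. On an antidiagonal
    the weight W is constant, so [negbin_convolution] makes their antidiagonal sums equal. Absolute
    summability comes from r < 1 for [a], and for [b] from the weights summing to 1. *)
Lemma thinned_series (A B c r : R) (W V : nat -> R) :
  hyper_weight A B c W V -> 0 < c - A -> 0 <= r < 1 ->
  gauss_sum A W 0 * Series (fun k =>
    negbin A k * (rising B k / rising (c - A) k) * (- r) ^ k) =
  Series (fun m => negbin A m * thinned W r m).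
Proof.
intros H HcA Hr; pose proof H as (HW & HV & Hs & _).
set (a := fun k j => negbin A k * (- r) ^ k * negbin A j * W (k + j)%nat).
set (b := fun m i => negbin A m * bin_weight (1 - r) r m i * W (m + i)%nat).
assert (Ea : is_series (fun n => antidiag a n) (Series (fun k => Series (a k)))).
{ assert (Ha : forall k j, Rabs (a k j) <=
    Rabs (negbin A k) * r ^ k * (Rabs (negbin A j) * V j)).
  { intros k j; unfold a; rewrite !Rabs_mult, <- RPow_abs, Rabs_Ropp.
    rewrite (Rabs_pos_eq r) by lra. rewrite Rmult_assoc.
    apply Rmult_le_compat_l.
    - apply Rmult_le_pos; [apply Rabs_pos | apply pow_le; lra].
    - apply Rmult_le_compat_l; [apply Rabs_pos|].
      rewrite Nat.add_comm; apply HV. }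
  assert (Hk : forall k, ex_series (fun j =>
    Rabs (negbin A k) * r ^ k * (Rabs (negbin A j) * V j)))
    by (intros k; apply (ex_series_Rmult (Rabs (negbin A k) * r ^ k)), Hs).
  apply series_antidiagonal.
  - intros k; apply (ex_series_dominated _ _) with (2 := Hk k).
    intros j; rewrite Rabs_Rabsolu; apply Ha.
  - apply ex_series_dominated with (fun k => Rabs (negbin A k) * r ^ k *
      Series (fun j => Rabs (negbin A j) * V j)).
    + intros k; rewrite <- Series_scal_l; apply Series_dominated; [|apply Hk].
      intros j; rewrite Rabs_Rabsolu; apply Ha.
    + apply (ex_series_scal_r _ _), ex_series_negbin_pow, Hr. }
assert (Hbs : forall m, is_series (b m) (negbin A m * thinned W r m)).
{ intros m. unfold thinned.
  replace (negbin A m * _) with (sum_f_R0 (b m) m).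
  - apply Series_finite; intros k Hk; unfold b.
    rewrite bin_weight_out by exact Hk; ring.
  - rewrite scal_sum; apply sum_eq; intros i _; unfold b; ring. }
assert (Eb : is_series (fun n => antidiag b n) (Series (fun m => Series (b m)))).
{ assert (Hb : forall m i, Rabs (b m i) <=
    bin_weight (1 - r) r m i * (Rabs (negbin A m) * V m)).
  { intros m i; unfold b; rewrite !Rabs_mult.
    rewrite (Rabs_pos_eq (bin_weight _ _ _ _))
      by (apply bin_weight_ge0; lra).
    rewrite (Rmult_comm (Rabs _)), Rmult_assoc.
    apply Rmult_le_compat_l; [apply bin_weight_ge0; lra|].
    apply Rmult_le_compat_l; [apply Rabs_pos | apply HV]. }
  assert (Hk : forall m, is_series (fun i =>
    bin_weight (1 - r) r m i * (Rabs (negbin A m) * V m))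
      (Rabs (negbin A m) * V m)).
  { intros m.
    pose proof (Series_finite _ m (bin_weight_out (1 - r) r m)) as E.
    rewrite bin_weight_sum in E; replace (1 - r + r) with 1 in E by ring.
    rewrite pow1 in E.
    apply (is_series_scal_r (Rabs (negbin A m) * V m)) in E.
    rewrite Rmult_1_l in E; exact E. }
  apply series_antidiagonal.
  - intros m; apply ex_series_dominated with (fun i =>
      bin_weight (1 - r) r m i * (Rabs (negbin A m) * V m)).
    + intros j; rewrite Rabs_Rabsolu; apply Hb.
    + eexists; apply Hk.
  - apply ex_series_dominated with (2 := Hs).
    intros m; rewrite <- (is_series_unique _ _ (Hk m)).
    apply Series_dominated; [|eexists; apply Hk].
    intros j; rewrite Rabs_Rabsolu; apply Hb. }
apply is_series_unique in Ea; apply is_series_unique in Eb.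
rewrite <- Series_scal_l.
transitivity (Series (fun k => Series (a k))).
- apply Series_ext; intros k.
  rewrite (Series_ext (a k) (fun j =>
    negbin A k * (- r) ^ k * (negbin A j * W (j + k)%nat))).
  2:{ intros j; unfold a; rewrite (Nat.add_comm j); ring. }
  rewrite Series_scal_l; fold (gauss_sum A W k).
  rewrite (gauss_sum_eq _ _ _ _ _ k H HcA); ring.
- rewrite <- Ea.
  transitivity (Series (fun m => Series (b m))).
  2:{ apply Series_ext; intros m; apply is_series_unique, Hbs. }
  rewrite <- Eb; apply Series_ext; intros n.
  pose proof (negbin_convolution A r n) as E.
  transitivity (W n *
    antidiag (fun k j => negbin A k * (- r) ^ k * negbin A j) n).
  + rewrite <- antidiag_scal; apply antidiag_ext; intros k j <-.
    unfold a; ring.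
  + rewrite E, <- antidiag_scal; apply antidiag_ext; intros m i <-.
    unfold b; ring.
Qed.

(** V_m bounds all of W_m, ..., W_2m and the weights sum to 1, so |e_m| V_m dominates the m-th term
    uniformly in r. *)
Lemma abel_limit (A B c : R) (W V : nat -> R) (r : nat -> R) :
  hyper_weight A B c W V -> 0 < c - A ->
  (forall n, 0 <= r n < 1) -> is_lim_seq r 1 ->
  is_lim_seq (fun n => gauss_sum A W 0 * Series (fun k =>
    negbin A k * (rising B k / rising (c - A) k) * (- r n) ^ k))
    (Series (fun m => negbin A m * W (m + m)%nat)).
Proof.
intros H HcA Hr Hr1; pose proof H as (_ & HV & Hs & _).
apply is_lim_seq_ext with
  (fun n => Series (fun m => negbin A m * thinned W (r n) m)).
{ intros n; symmetry; apply (thinned_series _ _ _ _ _ _ H HcA (Hr n)). }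
apply Tannery with (fun m => Rabs (negbin A m) * V m); [|exact Hs|].
- intros n m; rewrite Rabs_mult; apply Rmult_le_compat_l; [apply Rabs_pos|].
  specialize (Hr n); unfold thinned.
  apply Rle_trans with (1 := Rsum_abs _ _).
  apply Rle_trans with
    (sum_f_R0 (fun i => bin_weight (1 - r n) (r n) m i * V m) m).
  + apply sum_Rle; intros i _; rewrite Rabs_mult.
    rewrite (Rabs_pos_eq (bin_weight _ _ _ _))
      by (apply bin_weight_ge0; lra).
    apply Rmult_le_compat_l; [apply bin_weight_ge0; lra | apply HV].
  + rewrite <- scal_sum, bin_weight_sum.
    replace (1 - r n + r n) with 1 by ring. rewrite pow1; lra.
- intros m; apply is_lim_seq_mult'; [apply is_lim_seq_const|].
  replace (W (m + m)%nat) with (sum_f_R0 (fun i =>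
    (if (i =? m)%nat then 1 else 0) * W (m + i)%nat) m).
  + apply is_lim_seq_sum with (a := fun n i =>
      bin_weight (1 - r n) (r n) m i * W (m + i)%nat).
    intros i; apply is_lim_seq_mult'; [|apply is_lim_seq_const].
    apply bin_weight_lim; [|exact Hr1].
    replace 0 with (1 - 1) by ring.
    apply is_lim_seq_minus'; [apply is_lim_seq_const | exact Hr1].
  + destruct m as [|m]; [simpl; ring|].
    rewrite tech5, Nat.eqb_refl.
    rewrite (sum_eq _ (fun _ => 0)).
    * rewrite sum_cte; ring.
    * intros i Hi; rewrite (proj2 (Nat.eqb_neq _ _)) by lia; ring.
Qed.

(** * Gauss's series at 1 *)

(** A positive limit would make x n comparable with 1 / n, against the divergence of the harmonic
    series. *)
Lemma summable_lim_INR_mult (x : nat -> R) (L : R) :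
  (forall n, 0 <= x n) -> ex_series x ->
  is_lim_seq (fun n => INR n * x n) L -> L = 0.
Proof.
intros Hx [s Hs] HL.
assert (HL0 : 0 <= L).
{ apply (is_lim_seq_le (fun _ => 0) (fun n => INR n * x n) 0 L);
    [|apply is_lim_seq_const | exact HL].
  intros n; apply Rmult_le_pos; [apply pos_INR | apply Hx]. }
destruct HL0 as [HL0|]; [exfalso|easy].
apply is_lim_seq_spec in HL.
destruct (HL (mkposreal (L / 2) ltac:(lra))) as [N HN]; simpl in HN.
apply is_series_iff_lim in Hs.
assert (Hd : is_lim_seq (fun n => sum_f_R0 x (n + n) - sum_f_R0 x n) 0).
{ replace 0 with (s - s) by ring. apply is_lim_seq_minus'; [|exact Hs].
  apply (is_lim_seq_subseq (sum_f_R0 x) s (fun n => (n + n)%nat));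
    [|exact Hs].
  intros P [M HM]; exists M; intros n Hn; apply HM; lia. }
apply is_lim_seq_spec in Hd.
destruct (Hd (mkposreal (L / 4) ltac:(lra))) as [M HM]; simpl in HM.
set (n := S (N + M)). specialize (HM n ltac:(unfold n; lia)).
assert (Hn : 0 < INR n) by (apply lt_0_INR; unfold n; lia).
(* each of the n terms between n and 2 n is at least (L / 2) / (2 n) *)
assert (Hk : forall k, (k <= n)%nat ->
  INR k * (L / (4 * INR n)) <= sum_f_R0 x (n + k) - sum_f_R0 x n).
{ intros k; induction k as [|k IH]; intros Hk.
  - rewrite Nat.add_0_r; simpl; lra.
  - rewrite Nat.add_succ_r, tech5, S_INR. specialize (IH ltac:(lia)).
    specialize (HN (S (n + k)) ltac:(unfold n; lia)).
    apply Rabs_def2 in HN.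
    assert (Hi : INR (S (n + k)) <= 2 * INR n).
    { replace (2 * INR n) with (INR (n + n)) by (rewrite plus_INR; ring).
      apply le_INR; lia. }
    assert (L / (4 * INR n) <= x (S (n + k))).
    { apply Rmult_le_reg_l with (2 * INR n); [lra|].
      replace (2 * INR n * (L / (4 * INR n))) with (L / 2) by (field; lra).
      apply Rle_trans with (INR (S (n + k)) * x (S (n + k))); [lra|].
      apply Rmult_le_compat_r; [apply Hx | exact Hi]. }
    lra. }
specialize (Hk n (Nat.le_refl n)).
replace (INR n * (L / (4 * INR n))) with (L / 4) in Hk by (field; lra).
rewrite Rabs_pos_eq in HM; lra.
Qed.

Definition pochratio (B c : R) (n : nat) : R := rising B n / rising c n.

Lemma pochratio_S (B c : R) (n : nat) : 0 < c ->
  (c + INR n) * pochratio B c (S n) = (B + INR n) * pochratio B c n.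
Proof.
intros Hc; unfold pochratio; simpl.
pose proof (rising_pos c n Hc); pose proof (pos_INR n); field; lra.
Qed.

Lemma pochratio_pos (B c : R) (n : nat) :
  0 < B -> 0 < c -> 0 < pochratio B c n.
Proof. intros; apply Rdiv_lt_0_compat; apply rising_pos; easy. Qed.

Lemma pochratio_decr (B c : R) (n k : nat) :
  0 < B -> B <= c -> pochratio B c (n + k) <= pochratio B c n.
Proof.
intros HB Hc; induction k as [|k IH]; [rewrite Nat.add_0_r; lra|].
rewrite Nat.add_succ_r; apply Rle_trans with (2 := IH).
pose proof (pos_INR (n + k)).
pose proof (pochratio_pos B c (n + k) HB ltac:(lra)).
apply Rmult_le_reg_l with (c + INR (n + k)); [lra|].
rewrite pochratio_S by lra. apply Rmult_le_compat_r; lra.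
Qed.

Definition gauss_term (A B c : R) (j : nat) : R :=
  negbin A j * pochratio B c j.

Lemma gauss_term_pos (A B c : R) (j : nat) :
  0 < A -> 0 < B -> 0 < c -> 0 < gauss_term A B c j.
Proof.
intros; apply Rmult_lt_0_compat;
  [apply negbin_pos | apply pochratio_pos]; easy.
Qed.

Lemma gauss_term_S (A B c : R) (j : nat) : 0 < c ->
  (c + INR j) * (INR (S j) * gauss_term A B c (S j)) =
  (A + INR j) * (B + INR j) * gauss_term A B c j.
Proof.
intros Hc; unfold gauss_term.
transitivity ((INR (S j) * negbin A (S j)) *
  ((c + INR j) * pochratio B c (S j))); [ring|].
rewrite negbin_S, pochratio_S by exact Hc; ring.
Qed.

(** Raabe's test in exact form: for large j the difference of consecutive values of j x_j is about
    (c - A - B) x_j. The plain ratio test is inconclusive, the ratio tending to 1. *)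
Lemma gauss_term_diff (A B c : R) (j : nat) : 0 < c ->
  (c + INR j) *
  (INR j * gauss_term A B c j - INR (S j) * gauss_term A B c (S j)) =
  ((c - A - B) * INR j - A * B) * gauss_term A B c j.
Proof.
intros Hc; rewrite Rmult_minus_distr_l, gauss_term_S by exact Hc; ring.
Qed.

Lemma gauss_series (A B c : R) : 0 < A -> 0 < B -> A + B < c ->
  ex_series (gauss_term A B c) /\
  is_lim_seq (fun j => INR j * gauss_term A B c j) 0.
Proof.
intros HA HB Hc. set (x := gauss_term A B c).
assert (Hx : forall j, 0 < x j) by (intros; apply gauss_term_pos; lra).
set (d := c - A - B). assert (Hd : 0 < d) by (unfold d; lra).
(* The threshold at which (d j - A B) / (c + j) reaches d / 2. Beyond it the differences of j x_j
   dominate (d / 2) x_j, so the partial sums are bounded by telescoping. *)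
destruct (archimed ((2 * A * B + c * d) / d)) as [H1 _].
set (N := Z.to_nat (up ((2 * A * B + c * d) / d))).
assert (HN : forall j, 2 * A * B + c * d <= d * INR (N + j)).
{ intros j.
  assert (HN : IZR (up ((2 * A * B + c * d) / d)) <= INR (N + j)).
  { rewrite INR_IZR_INZ; apply IZR_le; unfold N; lia. }
  apply (Rmult_le_compat_l d) in HN; [|lra].
  apply Rle_trans with (2 := HN). apply (Rmult_gt_compat_l d) in H1; [|lra].
  replace (d * ((2 * A * B + c * d) / d)) with (2 * A * B + c * d) in H1
    by (field; lra). lra. }
assert (Hstep : forall j, d / 2 * x (N + j)%nat <=
  INR (N + j) * x (N + j)%nat - INR (S (N + j)) * x (S (N + j))).
{ intros j. pose proof (gauss_term_diff A B c (N + j) ltac:(lra)) as E.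
  fold x in E. specialize (HN j). pose proof (pos_INR (N + j)).
  apply Rmult_le_reg_l with (c + INR (N + j)); [lra|].
  rewrite E, <- Rmult_assoc. apply Rmult_le_compat_r; [apply Rlt_le, Hx|].
  fold d; nra. }
assert (Hex : ex_series x).
{ apply (ex_series_incr_n x N).
  apply ex_series_bounded with (2 / d * (INR N * x N)).
  - intros; apply Rlt_le, Hx.
  - intros n. apply Rle_trans with
      (2 / d * (INR N * x N - INR (S (N + n)) * x (S (N + n)))).
    + induction n as [|n IH].
      * specialize (Hstep O). simpl sum_f_R0.
        apply Rmult_le_reg_l with (d / 2); [lra|].
        rewrite <- Rmult_assoc. replace (d / 2 * (2 / d)) with 1
          by (field; lra). rewrite Nat.add_0_r in *; lra.
      * rewrite tech5. specialize (Hstep (S n)).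
        apply Rmult_le_reg_l with (d / 2); [lra|].
        apply (Rmult_le_compat_l (d / 2)) in IH; [|lra].
        rewrite <- Rmult_assoc in *.
        replace (d / 2 * (2 / d)) with 1 in * by (field; lra).
        rewrite Nat.add_succ_r in *; lra.
    + apply Rmult_le_compat_l; [apply Rlt_le, Rdiv_lt_0_compat; lra|].
      pose proof (Rmult_le_pos _ _ (pos_INR (S (N + n)))
        (Rlt_le _ _ (Hx (S (N + n))))); lra. }
split; [exact Hex|].
(* Beyond [N] the sequence j x_j decreases, by [Hstep]; its limit is then forced to be 0 by
   summability. *)
destruct (ex_finite_lim_seq_decr
  (fun j => INR (N + j) * x (N + j)%nat) 0) as [L HL].
- intros j; rewrite Nat.add_succ_r. specialize (Hstep j).
  pose proof (Rmult_lt_0_compat _ _ Hd (Hx (N + j)%nat)); lra.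
- intros j; apply Rmult_le_pos; [apply pos_INR | apply Rlt_le, Hx].
- assert (HL' : is_lim_seq (fun j => INR j * x j) L).
  { apply (is_lim_seq_incr_n _ N).
    apply is_lim_seq_ext with (2 := HL); intros j.
    rewrite Nat.add_comm; reflexivity. }
  rewrite <- (summable_lim_INR_mult x L); auto.
  intros; apply Rlt_le, Hx.
Qed.

(** Since B <= c the weights are positive and nonincreasing, so the sequence serves as its own
    envelope V. *)
Lemma pochratio_weight (A B c : R) : 0 < A -> 0 < B -> A + B < c ->
  hyper_weight A B c (pochratio B c) (pochratio B c).
Proof.
intros HA HB Hc. destruct (gauss_series A B c HA HB Hc) as [H1 H2].
repeat split.
- intros n; apply pochratio_S; lra.
- intros n k; rewrite Rabs_pos_eq by (apply Rlt_le, pochratio_pos; lra).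
  apply pochratio_decr; lra.
- apply ex_series_ext with (2 := H1); intros j.
  rewrite Rabs_pos_eq by (apply Rlt_le, negbin_pos; lra). reflexivity.
- intros k.
  apply is_lim_seq_le_le with (fun _ => 0) (fun j => INR j * gauss_term A B c j);
    [|apply is_lim_seq_const|exact H2].
  intros j; pose proof (negbin_pos A j HA); pose proof (pos_INR j).
  pose proof (pochratio_pos B c (j + k) HB ltac:(lra)).
  split; [apply Rmult_le_pos; [apply Rmult_le_pos|]; lra|].
  unfold gauss_term; rewrite Rmult_assoc.
  apply Rmult_le_compat_l; [lra|]. apply Rmult_le_compat_l; [lra|].
  apply pochratio_decr; lra.
Qed.

Definition gauss_value (A B c : R) : R := Series (gauss_term A B c).

Lemma rising_shift (c : R) (n : nat) :
  c * rising (c + 1) n = rising c n * (c + INR n).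
Proof.
induction n as [|n IH]; [simpl; ring|].
rewrite S_INR; simpl rising.
rewrite <- Rmult_assoc, IH; ring.
Qed.

Lemma gauss_term_shift (A B c : R) (j : nat) : 0 < c ->
  (c + INR j) * gauss_term A B (c + 1) j = c * gauss_term A B c j.
Proof.
intros Hc; unfold gauss_term, pochratio.
pose proof (rising_pos c j Hc); pose proof (rising_pos (c + 1) j ltac:(lra)).
pose proof (pos_INR j).
replace (rising c j) with (c * rising (c + 1) j / (c + INR j))
  by (rewrite rising_shift; field; lra).
field; lra.
Qed.

(** The termwise difference of the two sides is c (j x_j - (j + 1) x_(j+1)), with x the terms for
    parameter c; it telescopes and j x_j tends to 0. *)
Lemma gauss_value_shift (A B c : R) : 0 < A -> 0 < B -> A + B < c ->
  c * (c - A - B) * gauss_value A B c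
  = (c - A) * (c - B) * gauss_value A B (c + 1).
Proof.
intros HA HB Hc.
destruct (gauss_series A B c HA HB Hc) as [H1 H2].
destruct (gauss_series A B (c + 1) HA HB ltac:(lra)) as [H3 _].
assert (E : is_series (fun j => c * (c - A - B) * gauss_term A B c j -
    (c - A) * (c - B) * gauss_term A B (c + 1) j) 0).
{ apply is_series_iff_lim.
  apply is_lim_seq_ext with
    (fun n => - c * (INR (S n) * gauss_term A B c (S n))).
  - assert (Hj : forall j, c * (c - A - B) * gauss_term A B c j -
      (c - A) * (c - B) * gauss_term A B (c + 1) j =
      c * (INR j * gauss_term A B c j - INR (S j) * gauss_term A B c (S j))).
    { intros j; pose proof (pos_INR j).
      pose proof (gauss_term_diff A B c j ltac:(lra)) as E1.
      pose proof (gauss_term_shift A B c j ltac:(lra)) as E2.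
      apply Rmult_eq_reg_l with (c + INR j); [|lra].
      transitivity (c * (c - A - B) * (c + INR j) * gauss_term A B c j -
        (c - A) * (c - B) * ((c + INR j) * gauss_term A B (c + 1) j));
        [ring|]. rewrite E2.
      transitivity (c * ((c + INR j) *
        (INR j * gauss_term A B c j - INR (S j) * gauss_term A B c (S j))));
        [rewrite E1|]; ring. }
    intros n; induction n as [|n IH].
    + simpl sum_f_R0; rewrite Hj; simpl INR; ring.
    + rewrite tech5, <- IH, Hj; ring.
  - replace 0 with (- c * 0) by ring.
    apply is_lim_seq_mult'; [apply is_lim_seq_const|].
    apply (is_lim_seq_incr_1 (fun n => INR n * gauss_term A B c n)), H2. }
apply is_series_unique in E.
rewrite Series_minus, !Series_scal_l in E by (apply ex_series_Rmult; easy).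
unfold gauss_value; lra.
Qed.

Lemma gauss_value_lim (A B c : R) : 0 < A -> 0 < B -> A + B < c ->
  is_lim_seq (fun n => gauss_value A B (c + INR n)) 1.
Proof.
intros HA HB Hc.
assert (Hex : forall n, ex_series (gauss_term A B (c + INR n))).
{ intros n; pose proof (pos_INR n); apply gauss_series; lra. }
assert (H0 : forall n, gauss_term A B (c + INR n) 0 = 1)
  by (intros n; unfold gauss_term, pochratio; rewrite negbin_0; simpl; field).
(* For indices j + 1 >= 1, [gauss_term_shift] makes c + n times the term nonincreasing in n. Hence
   everything beyond the constant term 1 is O(1 / (c + n)). *)
assert (Hb : forall n j,
    (c + INR n) * gauss_term A B (c + INR n) (S j) <= c * gauss_term A B c (S j)).
{ intros n j; induction n as [|n IH].
  - simpl INR; rewrite Rplus_0_r; lra.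
  - apply Rle_trans with (2 := IH). pose proof (pos_INR n).
    pose proof (gauss_term_shift A B (c + INR n) (S j) ltac:(lra)) as E.
    rewrite <- E, S_INR, <- Rplus_assoc.
    pose proof (gauss_term_pos A B (c + INR n + 1) (S j) HA HB ltac:(lra)).
    apply Rmult_le_compat_r; [lra|]. rewrite S_INR.
    pose proof (pos_INR j); lra. }
set (T := Series (fun j => gauss_term A B c (S j))).
assert (Hc0 : ex_series (gauss_term A B c)) by (apply gauss_series; lra).
assert (Hsp : forall n, gauss_value A B (c + INR n) =
   1 + Series (fun j => gauss_term A B (c + INR n) (S j))).
{ intros n; unfold gauss_value; rewrite Series_incr_1 by apply Hex.
  rewrite H0; reflexivity. }
apply is_lim_seq_le_le with (fun _ => 1) (fun n => 1 + c * T * / (c + INR n)).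
- intros n; rewrite Hsp. pose proof (pos_INR n).
  assert (Hp : forall j, 0 <= gauss_term A B (c + INR n) (S j))
    by (intros j; apply Rlt_le, gauss_term_pos; lra).
  split.
  + pose proof (Series_le (fun _ => 0 * 0)
      (fun j => gauss_term A B (c + INR n) (S j))) as H1.
    rewrite Series_scal_l in H1.
    enough (0 <= Series (fun j => gauss_term A B (c + INR n) (S j))) by lra.
    apply Rle_trans with (0 * Series (fun _ => 0)); [lra|apply H1].
    * intros j; specialize (Hp j); lra.
    * apply (ex_series_incr_1 (gauss_term A B (c + INR n))), Hex.
  + apply Rplus_le_compat_l.
    apply Rmult_le_reg_l with (c + INR n); [lra|].
    replace ((c + INR n) * (c * T * / (c + INR n))) with (c * T)
      by (field; lra).
    unfold T; rewrite <- !Series_scal_l. apply Series_le.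
    * intros j; split; [|apply Hb]. apply Rmult_le_pos; [lra|apply Hp].
    * apply ex_series_Rmult, (ex_series_incr_1 (gauss_term A B c)), Hc0.
- apply is_lim_seq_const.
- replace 1 with (1 + c * T * 0) at 1 by ring.
  apply is_lim_seq_plus'; [apply is_lim_seq_const|].
  apply is_lim_seq_mult'; [apply is_lim_seq_const|].
  apply is_lim_seq_inv_INR; lra.
Qed.

(** * The Gamma function *)

Lemma is_RInt_gen_ge0 (f : R -> R) (l : R) :
  (forall t, 0 < t -> 0 <= f t) ->
  is_RInt_gen f (at_right 0) (Rbar_locally p_infty) l -> 0 <= l.
Proof.
intros Hf Hl. destruct (Rle_or_lt 0 l) as [|Hl0]; [easy|exfalso].
assert (HP : locally l (fun y => y < 0)) by apply (open_lt 0 l Hl0).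
destruct (Hl _ HP) as [Q S [d HQ] [M HS] H].
set (a := d / 2). set (b := Rmax 1 (M + 1) + a).
assert (Ha : 0 < a) by (unfold a; destruct d; simpl; lra).
destruct (H a b) as [y [Hy Hy0]].
- apply HQ; [|exact Ha]. change (Rabs (a - 0) < d).
  rewrite Rminus_0_r, Rabs_pos_eq by lra; unfold a; destruct d; simpl in *; lra.
- apply HS. unfold b; pose proof (Rmax_r 1 (M + 1)); lra.
- simpl in Hy. assert (Hab : a < b)
    by (unfold b; pose proof (Rmax_l 1 (M + 1)); lra).
  enough (0 <= y) by lra.
  apply (is_RInt_le (fun _ => 0) f a b 0 y (Rlt_le _ _ Hab)).
  + pose proof (is_RInt_const a b (0 : R)) as H0.
    change (is_RInt (fun _ : R => 0) a b ((b - a) * 0)) in H0.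
    rewrite Rmult_0_r in H0; exact H0.
  + exact Hy.
  + intros t Ht; apply Hf; lra.
Qed.

Lemma ex_RInt_pos (f : R -> R) (a b : R) :
  (forall t, 0 < t -> continuous f t) -> 0 < a -> 0 < b -> ex_RInt f a b.
Proof.
intros Hc Ha Hb; apply (ex_RInt_continuous f); intros t [Ht _]; apply Hc.
apply Rlt_le_trans with (2 := Ht); unfold Rmin; destruct (Rle_dec a b); lra.
Qed.

Lemma RInt_mono_interval (f : R -> R) (a a' b b' : R) :
  (forall t, 0 < t -> continuous f t) -> (forall t, 0 < t -> 0 <= f t) ->
  0 < a' <= a -> a <= b <= b' -> RInt f a b <= RInt f a' b'.
Proof.
intros Hc Hf Ha Hb.
assert (Hex : forall x y, 0 < x -> 0 < y -> ex_RInt f x y)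
  by (intros; apply ex_RInt_pos; easy).
rewrite <- (RInt_Chasles f a' a b'), <- (RInt_Chasles f a b b')
  by (apply Hex; lra).
unfold plus; simpl.
assert (H1 : 0 <= RInt f a' a)
  by (apply RInt_ge_0; [lra | apply Hex; lra | intros; apply Hf; lra]).
assert (H2 : 0 <= RInt f b b')
  by (apply RInt_ge_0; [lra | apply Hex; lra | intros; apply Hf; lra]).
lra.
Qed.

(** Monotone convergence: the improper integral is the supremum of the integrals over compact
    intervals, which grow with the interval. *)
Lemma is_RInt_gen_bounded (f : R -> R) (K : R) :
  (forall t, 0 < t -> continuous f t) -> (forall t, 0 < t -> 0 <= f t) ->
  (forall a b, 0 < a <= b -> RInt f a b <= K) ->
  exists l, is_RInt_gen f (at_right 0) (Rbar_locally p_infty) l /\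
    forall a b, 0 < a <= b -> RInt f a b <= l.
Proof.
intros Hc Hf HK.
destruct (completeness (fun y => exists a b, 0 < a <= b /\ y = RInt f a b))
  as [l [Hl1 Hl2]].
- exists K; intros y (a & b & Hab & ->); apply HK, Hab.
- exists (RInt f 1 1), 1, 1; split; [lra|easy].
- assert (Hle : forall a b, 0 < a <= b -> RInt f a b <= l)
    by (intros a b Hab; apply Hl1; exists a, b; easy).
  exists l; split; [|exact Hle].
  intros P [e HP].
  assert (Hab : exists a b, 0 < a <= b /\ l - e < RInt f a b).
  { destruct (Classical_Prop.classic
      (exists a b, 0 < a <= b /\ l - e < RInt f a b)) as [H|H]; [easy|].
    assert (l <= l - e); [|destruct e; simpl in *; lra].
    apply Hl2; intros y (a & b & Hab & ->).
    apply Rnot_lt_le; intros Hlt; apply H; exists a, b; easy. }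
  destruct Hab as (a & b & Hab & Hlt).
  apply Filter_prod with (fun x => 0 < x < a) (fun x => b < x).
  + exists (mkposreal a (proj1 Hab)); intros x Hx H0.
    apply Rabs_def2 in Hx. unfold minus, plus, opp in Hx; simpl in Hx; lra.
  + exists b; easy.
  + intros x y Hx Hy; exists (RInt f x y); split.
    * apply (RInt_correct f), ex_RInt_pos; simpl; try easy; lra.
    * apply HP. pose proof (RInt_mono_interval f a x b y Hc Hf) as H1.
      pose proof (Hle x y). change (Rabs (RInt f x y - l) < e).
      apply Rabs_def1; destruct e; simpl in *; lra.
Qed.

Definition gamma_integrand (x t : R) : R := Rpower t (x - 1) * exp (- t).

Lemma exp_le (x y : R) : x <= y -> exp x <= exp y.
Proof. intros [H| ->]; [apply Rlt_le, exp_increasing, H | lra]. Qed.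

Lemma Rpower_pos (x y : R) : 0 < Rpower x y.
Proof. apply exp_pos. Qed.

Lemma gamma_integrand_pos (x t : R) : 0 < gamma_integrand x t.
Proof. apply Rmult_lt_0_compat; [apply Rpower_pos | apply exp_pos]. Qed.

Lemma gamma_integrand_continuous (x t : R) :
  0 < t -> continuous (gamma_integrand x) t.
Proof.
intros Ht; apply (ex_derive_continuous (gamma_integrand x)).
unfold gamma_integrand, Rpower; auto_derive; easy.
Qed.

(** For t > 1 compare t^y with t^n, n >= y, and use the Taylor term t^n / n! of exp t; for t <= 1
    the power is at most 1. *)
Lemma Rpower_exp_bounded (y : R) : 0 <= y ->
  exists K, forall t, 0 < t -> Rpower t y * exp (- t) <= K.
Proof.
intros Hy.
set (n := Z.to_nat (up y)).
assert (Hn : y <= INR n).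
{ destruct (archimed y) as [H _]. apply Rle_trans with (1 := Rlt_le _ _ H).
  rewrite INR_IZR_INZ; apply IZR_le; unfold n; lia. }
exists (1 + INR (fact n)); intros t Ht.
rewrite exp_Ropp. apply Rmult_le_reg_r with (exp t); [apply exp_pos|].
rewrite Rmult_assoc, Rinv_l, Rmult_1_r by apply Rgt_not_eq, exp_pos.
assert (He : 1 <= exp t) by (pose proof (exp_ineq1 t); lra).
assert (Hpow : t ^ n <= INR (fact n) * exp t).
{ pose proof (exp_ge_taylor t n (Rlt_le _ _ Ht)) as H.
  assert (H1 : t ^ n / INR (fact n) <= exp t).
  { apply Rle_trans with (2 := H). destruct n as [|m]; [simpl; lra|].
    rewrite tech5, <- (Rplus_0_l (t ^ S m / INR (fact (S m)))) at 1.
    apply Rplus_le_compat_r, cond_pos_sum; intros k.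
    apply Rlt_le, Rdiv_lt_0_compat; [apply pow_lt, Ht|apply INR_fact_lt_0]. }
  pose proof (INR_fact_lt_0 n) as Hf.
  apply (Rmult_le_compat_l (INR (fact n))) in H1; [|lra].
  replace (INR (fact n) * (t ^ n / INR (fact n))) with (t ^ n) in H1
    by (field; lra). exact H1. }
destruct (Rle_or_lt t 1) as [H1|H1].
- apply Rle_trans with (exp t).
  + apply Rle_trans with 1; [|exact He].
    unfold Rpower; rewrite <- exp_0. apply exp_le.
    assert (ln t <= 0) by (rewrite <- ln_1; apply ln_le; lra).
    nra.
  + pose proof (INR_fact_lt_0 n). nra.
- apply Rle_trans with (t ^ n).
  + rewrite <- Rpower_pow by exact Ht. apply Rle_Rpower; lra.
  + lra.
Qed.

(** A single majorant handles both ends: K t^(x - 1) / (1 + t^x)^2 behaves like t^(x - 1) near 0, is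
    integrable at infinity, and has the bounded primitive [h]. *)
Lemma gamma_integral_bounded (x : R) : 0 < x ->
  exists K, forall a b, 0 < a <= b -> RInt (gamma_integrand x) a b <= K.
Proof.
intros Hx.
destruct (Rpower_exp_bounded x ltac:(lra)) as [K1 H1].
destruct (Rpower_exp_bounded (x + x) ltac:(lra)) as [K2 H2].
(* A bound for (1 + t^x)^2 exp (- t), expanded into its three terms. *)
set (K := 1 + 2 * K1 + K2).
set (h := fun t => - (K / x) / (1 + Rpower t x)).
set (h' := fun t => K * Rpower t (x - 1) / (1 + Rpower t x) ^ 2).
assert (HK : forall t, 0 < t -> gamma_integrand x t <= h' t).
{ intros t Ht; specialize (H1 t Ht); specialize (H2 t Ht).
  pose proof (Rpower_pos t x) as Hp. unfold h', gamma_integrand.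
  apply Rmult_le_reg_r with ((1 + Rpower t x) ^ 2); [apply pow_lt; lra|].
  replace (K * Rpower t (x - 1) / (1 + Rpower t x) ^ 2 *
    (1 + Rpower t x) ^ 2) with (Rpower t (x - 1) * K) by (field; lra).
  rewrite Rmult_assoc. apply Rmult_le_compat_l; [apply Rlt_le, Rpower_pos|].
  rewrite Rpower_plus in H2.
  assert (exp (- t) <= 1)
    by (rewrite <- exp_0; apply exp_le; lra).
  unfold K; simpl; nra. }
assert (Hpow : forall t, 0 < t -> Rpower t (x - 1) = Rpower t x / t).
{ intros t Ht; unfold Rminus; rewrite Rpower_plus, Rpower_Ropp, Rpower_1;
    easy. }
assert (Hd : forall t, 0 < t -> is_derive h t (h' t)).
{ intros t Ht; pose proof (Rpower_pos t x) as Hp.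
  unfold h, h'; rewrite (Hpow t Ht).
  unfold Rpower in *; auto_derive; [repeat split; lra|].
  field; lra. }
assert (Hc : forall t, 0 < t -> continuous h' t).
{ intros t Ht; pose proof (Rpower_pos t x) as Hp.
  apply (ex_derive_continuous h'). unfold h', Rpower in *.
  auto_derive; repeat split; try lra.
  apply Rgt_not_eq, Rmult_lt_0_compat; lra. }
assert (HK0 : 0 <= K / x).
{ apply Rlt_le, Rdiv_lt_0_compat; [|exact Hx].
  specialize (H1 1 ltac:(lra)); specialize (H2 1 ltac:(lra)).
  pose proof (Rmult_lt_0_compat _ _ (Rpower_pos 1 x) (exp_pos (- (1)))).
  pose proof (Rmult_lt_0_compat _ _ (Rpower_pos 1 (x + x)) (exp_pos (- (1)))).
  unfold K; lra. }
exists (K / x); intros a b Hab.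
assert (Hm : forall t, Rmin a b <= t -> 0 < t)
  by (intros t Ht; rewrite Rmin_left in Ht; lra).
assert (HR : is_RInt h' a b (h b - h a)).
{ apply (is_RInt_derive h h'); intros t Ht; [apply Hd|apply Hc];
    apply Hm, Ht. }
apply Rle_trans with (RInt h' a b).
- apply RInt_le; [lra| | |].
  + apply ex_RInt_pos; try lra. intros; apply gamma_integrand_continuous; easy.
  + eexists; exact HR.
  + intros t Ht; apply HK; lra.
- rewrite (is_RInt_unique _ _ _ _ HR). unfold h.
  pose proof (Rpower_pos a x) as Pa; pose proof (Rpower_pos b x) as Pb.
  assert (0 <= K / x / (1 + Rpower b x))
    by (apply Rmult_le_pos; [lra | apply Rlt_le, Rinv_0_lt_compat; lra]).
  assert (K / x / (1 + Rpower a x) <= K / x).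
  { rewrite <- (Rmult_1_r (K / x)) at 2. apply Rmult_le_compat_l; [lra|].
    rewrite <- Rinv_1; apply Rinv_le_contravar; lra. }
  unfold Rdiv in *; lra.
Qed.

(** [RInt_gen] carries no information until convergence is known, so [Gamma x] is first identified
    with the supremum above. It is positive because the integral over [1, 2] already is. *)
Lemma Gamma_spec (x : R) : 0 < x ->
  is_RInt_gen (gamma_integrand x) (at_right 0) (Rbar_locally p_infty) (Gamma x)
  /\ 0 < Gamma x.
Proof.
intros Hx. destruct (gamma_integral_bounded x Hx) as [K HK].
destruct (is_RInt_gen_bounded (gamma_integrand x) K) as (l & Hl & Hle).
- intros; apply gamma_integrand_continuous; easy.
- intros; apply Rlt_le, gamma_integrand_pos.
- exact HK.
- assert (E : Gamma x = l) by (apply is_RInt_gen_unique; exact Hl).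
  rewrite E; split; [exact Hl|].
  apply Rlt_le_trans with (2 := Hle 1 2 ltac:(lra)).
  apply RInt_gt_0; [lra| |].
  + intros; apply gamma_integrand_pos.
  + intros t Ht; apply continuity_pt_filterlim.
    apply continuity_pt_filterlim, gamma_integrand_continuous; lra.
Qed.

Lemma Gamma_pos (x : R) : 0 < x -> 0 < Gamma x.
Proof. apply Gamma_spec. Qed.

(** Integration by parts: - t^x exp (- t) is a primitive of the difference of the two integrands and
    tends to 0 at both ends. *)
Lemma Gamma_S (x : R) : 0 < x -> Gamma (x + 1) = x * Gamma x.
Proof.
intros Hx.
set (f := fun t => - (Rpower t x * exp (- t))).
assert (Hd : forall t, 0 < t ->
  is_derive f t (gamma_integrand (x + 1) t - x * gamma_integrand x t)).
{ intros t Ht; unfold f, gamma_integrand.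
  replace (x + 1 - 1) with x by ring.
  replace (Rpower t (x - 1)) with (Rpower t x / t).
  2:{ unfold Rminus; rewrite Rpower_plus, Rpower_Ropp, Rpower_1; easy. }
  unfold Rpower; auto_derive; [easy|]. field; lra. }
assert (Hc : forall t, 0 < t -> continuous
  (fun t => gamma_integrand (x + 1) t - x * gamma_integrand x t) t).
{ intros t Ht; apply (continuous_minus (gamma_integrand (x + 1))
    (fun t => x * gamma_integrand x t)).
  - apply gamma_integrand_continuous, Ht.
  - apply (continuous_scal_r x (gamma_integrand x)).
    apply gamma_integrand_continuous, Ht. }
assert (Hprod : forall P : R -> Prop, (forall t, 0 < t -> P t) ->
  filter_prod (at_right 0) (Rbar_locally p_infty) (fun ab => forall t,
    Rmin (fst ab) (snd ab) <= t <= Rmax (fst ab) (snd ab) -> P t)).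
{ intros P HP. apply Filter_prod with (fun a => 0 < a) (fun b => 0 < b).
  - exists (mkposreal 1 Rlt_0_1); intros; easy.
  - exists 0; easy.
  - intros a b Ha Hb t [Ht _]; apply HP; simpl in Ht.
    apply Rlt_le_trans with (2 := Ht), Rmin_glb_lt; easy. }
(* Near 0, t^x < e as soon as t < e^(1/x). At infinity ([H1]), the bound t^(x + 1) exp (- t) <= K
   gives t^x exp (- t) <= K / t. *)
assert (H0 : filterlim f (at_right 0) (locally 0)).
{ intros P [e HP]. exists (mkposreal _ (Rpower_pos e (/ x))).
  intros t Ht Ht0. apply HP. change (Rabs (t - 0) < Rpower e (/ x)) in Ht.
  rewrite Rminus_0_r, Rabs_pos_eq in Ht by lra.
  change (Rabs (f t - 0) < e). unfold f.
  rewrite Rminus_0_r, Rabs_Ropp, Rabs_pos_eq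
    by (apply Rmult_le_pos; [apply Rlt_le, Rpower_pos|apply Rlt_le, exp_pos]).
  assert (He : exp (- t) <= 1) by (rewrite <- exp_0; apply exp_le; lra).
  assert (Hp : Rpower t x < e).
  { replace (pos e) with (Rpower (Rpower e (/ x)) x).
    - apply Rlt_Rpower_l; [exact Hx | lra].
    - rewrite Rpower_mult, Rinv_l, Rpower_1;
        [easy | destruct e; easy | lra]. }
  pose proof (Rpower_pos t x); pose proof (exp_pos (- t)); nra. }
assert (H1 : filterlim f (Rbar_locally p_infty) (locally 0)).
{ destruct (Rpower_exp_bounded (x + 1) ltac:(lra)) as [K HK].
  intros P [e HP]. exists (Rmax 1 (K / e)). intros t Ht. apply HP.
  assert (Ht1 : 1 < t) by (apply Rle_lt_trans with (2 := Ht), Rmax_l).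
  assert (Ht2 : K / e < t) by (apply Rle_lt_trans with (2 := Ht), Rmax_r).
  change (Rabs (f t - 0) < e). unfold f.
  rewrite Rminus_0_r, Rabs_Ropp, Rabs_pos_eq
    by (apply Rmult_le_pos; [apply Rlt_le, Rpower_pos|apply Rlt_le, exp_pos]).
  specialize (HK t ltac:(lra)). rewrite Rpower_plus, Rpower_1 in HK by lra.
  destruct e as [e He]; simpl in *.
  apply Rmult_lt_reg_r with t; [lra|].
  apply (Rmult_lt_compat_l e) in Ht2; [|lra].
  replace (e * (K / e)) with K in Ht2 by (field; lra). lra. }
assert (HI : is_RInt_gen (Derive f) (at_right 0) (Rbar_locally p_infty)
  (0 - 0)).
{ apply is_RInt_gen_Derive; try easy.
  - apply Hprod; intros t Ht; eexists; apply Hd, Ht.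
  - apply Hprod; intros t Ht.
    apply continuous_ext_loc with (2 := Hc t Ht).
    exists (mkposreal t Ht); intros s Hs. symmetry.
    apply is_derive_unique, Hd. change (Rabs (s - t) < t) in Hs.
    apply Rabs_def2 in Hs; lra. }
destruct (Gamma_spec x Hx) as [G1 _].
destruct (Gamma_spec (x + 1) ltac:(lra)) as [G2 _].
apply (is_RInt_gen_scal _ x) in G1.
pose proof (is_RInt_gen_minus _ _ _ _ G2 G1) as G.
apply (is_RInt_gen_ext (Derive f)
  (fun t => minus (gamma_integrand (x + 1) t) (scal x (gamma_integrand x t))))
  in HI.
- pose proof (is_RInt_gen_unique _ _ G) as E1.
  pose proof (is_RInt_gen_unique _ _ HI) as E2.
  pose proof (eq_trans (eq_sym E1) E2) as E.
  unfold minus, plus, opp, scal in E; simpl in E.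
  unfold mult in E; simpl in E; lra.
- destruct (Hprod (fun t => Derive f t =
    minus (gamma_integrand (x + 1) t) (scal x (gamma_integrand x t))))
    as [Q S HQ HS H].
  + intros t Ht; apply is_derive_unique, Hd, Ht.
  + apply Filter_prod with (1 := HQ) (2 := HS).
    intros a b Ha Hb t Ht; apply (H a b Ha Hb); simpl in *; lra.
Qed.

(* With tau^A = Gamma (y + A) / Gamma y, integrate
   (t^A - tau^A) (t^D - tau^D) >= 0 against t^(y - 1) exp (- t). *)
Lemma Gamma_supermultiplicative (y A D : R) : 0 < y -> 0 < A -> 0 < D ->
  Gamma (y + A) * Gamma (y + D) <= Gamma (y + A + D) * Gamma y.
Proof.
intros Hy HA HD.
destruct (Gamma_spec y Hy) as [G0 P0].
destruct (Gamma_spec (y + A) ltac:(lra)) as [GA PA].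
destruct (Gamma_spec (y + D) ltac:(lra)) as [GD PD].
destruct (Gamma_spec (y + A + D) ltac:(lra)) as [GAD PAD].
set (k := Gamma (y + A) / Gamma y).
assert (Hk : 0 < k) by (apply Rdiv_lt_0_compat; easy).
set (tau := Rpower k (/ A)). set (q := Rpower tau D).
assert (Htau : Rpower tau A = k).
{ unfold tau; rewrite Rpower_mult, Rinv_l, Rpower_1; lra. }
pose proof (is_RInt_gen_minus _ _ _ _ GAD (is_RInt_gen_scal _ k _ GD)) as I1.
pose proof (is_RInt_gen_minus _ _ _ _ GA (is_RInt_gen_scal _ k _ G0)) as I2.
pose proof (is_RInt_gen_minus _ _ _ _ I1 (is_RInt_gen_scal _ q _ I2)) as I.
apply is_RInt_gen_ge0 in I.
- unfold minus, plus, opp, scal in I; simpl in I; unfold mult in I; simpl in I.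
  assert (E : k * Gamma y = Gamma (y + A)) by (unfold k; field; lra).
  rewrite E in I.
  assert (I' : k * Gamma (y + D) <= Gamma (y + A + D)) by lra.
  apply (Rmult_le_compat_r (Gamma y)) in I'; [|lra].
  replace (k * Gamma (y + D) * Gamma y) with (k * Gamma y * Gamma (y + D))
    in I' by ring. rewrite E in I'; exact I'.
- intros t Ht.
  unfold minus, plus, opp, scal; simpl; unfold mult; simpl.
  unfold gamma_integrand.
  replace (y + A + D - 1) with (y - 1 + A + D) by ring.
  replace (y + D - 1) with (y - 1 + D) by ring.
  replace (y + A - 1) with (y - 1 + A) by ring.
  rewrite !Rpower_plus.
  replace (_ + - _) with (Rpower t (y - 1) * exp (- t) *
    ((Rpower t A - k) * (Rpower t D - q))) by ring.
  apply Rmult_le_pos.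
  + apply Rmult_le_pos; [apply Rlt_le, Rpower_pos | apply Rlt_le, exp_pos].
  + rewrite <- Htau; unfold q.
    assert (Htp : 0 < tau) by apply Rpower_pos.
    destruct (Rle_or_lt tau t) as [H|H].
    * apply Rmult_le_pos.
      -- pose proof (Rle_Rpower_l tau t A ltac:(lra) ltac:(split; lra)); lra.
      -- pose proof (Rle_Rpower_l tau t D ltac:(lra) ltac:(split; lra)); lra.
    * pose proof (Rle_Rpower_l t tau A ltac:(lra) ltac:(split; lra)).
      pose proof (Rle_Rpower_l t tau D ltac:(lra) ltac:(split; lra)).
      rewrite <- Rmult_opp_opp; apply Rmult_le_pos; lra.
Qed.

Lemma Gamma_rising (x : R) (n : nat) : 0 < x ->
  Gamma (x + INR n) = rising x n * Gamma x.
Proof.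
intros Hx; induction n as [|n IH]; [simpl; rewrite Rplus_0_r; ring|].
rewrite S_INR, <- Rplus_assoc, Gamma_S by (pose proof (pos_INR n); lra).
rewrite IH; simpl; ring.
Qed.

Definition gamma_ratio (A B c : R) : R :=
  Gamma c * Gamma (c - A - B) / (Gamma (c - A) * Gamma (c - B)).

Lemma gamma_ratio_shift (A B c : R) : 0 < A -> 0 < B -> A + B < c ->
  c * (c - A - B) * gamma_ratio A B c
  = (c - A) * (c - B) * gamma_ratio A B (c + 1).
Proof.
intros HA HB Hc; unfold gamma_ratio.
replace (c + 1 - A - B) with (c - A - B + 1) by ring.
replace (c + 1 - A) with (c - A + 1) by ring.
replace (c + 1 - B) with (c - B + 1) by ring.
rewrite !Gamma_S by lra.
pose proof (Gamma_pos (c - A) ltac:(lra)).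
pose proof (Gamma_pos (c - B) ltac:(lra)).
field; lra.
Qed.

Lemma gamma_ratio_ge1 (A B c : R) : 0 < A -> 0 < B -> A + B < c ->
  1 <= gamma_ratio A B c.
Proof.
intros HA HB Hc; unfold gamma_ratio.
pose proof (Gamma_supermultiplicative (c - A - B) B A
  ltac:(lra) ltac:(lra) ltac:(lra)) as H.
replace (c - A - B + B + A) with c in H by ring.
replace (c - A - B + B) with (c - A) in H by ring.
replace (c - A - B + A) with (c - B) in H by ring.
pose proof (Rmult_lt_0_compat _ _ (Gamma_pos (c - A) ltac:(lra))
  (Gamma_pos (c - B) ltac:(lra))) as Hp.
apply Rmult_le_reg_r with (1 := Hp).
unfold Rdiv; rewrite Rmult_assoc, Rinv_l, Rmult_1_r, Rmult_1_l by lra.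
exact H.
Qed.

(** [Gamma_supermultiplicative] at y = c - A with increments A and M - B. As M is an integer, the
    shifted Gamma values reduce to rising factorials, and the bound is a rational function that
    tends to 1 as c grows. *)
Lemma gamma_ratio_le (A B c : R) (M : nat) :
  0 < A -> 0 < B -> A + B < c -> B < INR M ->
  gamma_ratio A B c <= rising (c - B) M / rising (c - A - B) M.
Proof.
intros HA HB Hc HM; unfold gamma_ratio.
pose proof (Gamma_supermultiplicative (c - A) A (INR M - B)
  ltac:(lra) ltac:(lra) ltac:(lra)) as H.
replace (c - A + A + (INR M - B)) with (c - B + INR M) in H by ring.
replace (c - A + A) with c in H by ring.
replace (c - A + (INR M - B)) with (c - A - B + INR M) in H by ring.
rewrite !Gamma_rising in H by lra.
pose proof (rising_pos (c - A - B) M ltac:(lra)) as Hr.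
pose proof (Rmult_lt_0_compat _ _ (Gamma_pos (c - A) ltac:(lra))
  (Gamma_pos (c - B) ltac:(lra))) as Hp.
apply Rmult_le_reg_r with (1 := Hp).
unfold Rdiv at 1; rewrite Rmult_assoc, Rinv_l, Rmult_1_r by lra.
apply Rmult_le_reg_r with (1 := Hr).
replace (rising (c - B) M / rising (c - A - B) M *
  (Gamma (c - A) * Gamma (c - B)) * rising (c - A - B) M) with
  (rising (c - B) M * Gamma (c - B) * Gamma (c - A)) by (field; lra).
lra.
Qed.

Lemma rising_ratio_lim (x y : R) (M : nat) : 0 < x -> 0 < y ->
  is_lim_seq (fun n => rising (x + INR n) M / rising (y + INR n) M) 1.
Proof.
intros Hx Hy; induction M as [|M IH].
- apply is_lim_seq_ext with (fun _ => 1); [|apply is_lim_seq_const].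
  intros; simpl; field.
- apply is_lim_seq_ext with (fun n =>
    rising (x + INR n) M / rising (y + INR n) M *
    (1 + (x - y) * / (y + INR M + INR n))).
  + intros n; simpl. pose proof (pos_INR n); pose proof (pos_INR M).
    pose proof (rising_pos (y + INR n) M ltac:(lra)). field; lra.
  + replace 1 with (1 * (1 + (x - y) * 0)) at 1 by ring.
    apply is_lim_seq_mult'; [exact IH|].
    apply is_lim_seq_plus'; [apply is_lim_seq_const|].
    apply is_lim_seq_mult'; [apply is_lim_seq_const|].
    apply is_lim_seq_inv_INR; pose proof (pos_INR M); lra.
Qed.

Lemma gamma_ratio_lim (A B c : R) : 0 < A -> 0 < B -> A + B < c ->
  is_lim_seq (fun n => gamma_ratio A B (c + INR n)) 1.
Proof.
intros HA HB Hc.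
assert (HM : exists M, B < INR M).
{ destruct (archimed B) as [H _]. exists (Z.to_nat (up B)).
  apply Rlt_le_trans with (1 := H). rewrite INR_IZR_INZ; apply IZR_le; lia. }
destruct HM as [M HM].
apply is_lim_seq_le_le with (fun _ => 1) (fun n =>
  rising (c - B + INR n) M / rising (c - A - B + INR n) M).
- intros n; pose proof (pos_INR n); split.
  + apply gamma_ratio_ge1; lra.
  + replace (c - B + INR n) with (c + INR n - B) by ring.
    replace (c - A - B + INR n) with (c + INR n - A - B) by ring.
    apply gamma_ratio_le; lra.
- apply is_lim_seq_const.
- apply rising_ratio_lim; lra.
Qed.

(* Both sides obey the same recurrence in c and tend to 1 as c grows. *)
Lemma gauss_summation (A B c : R) : 0 < A -> 0 < B -> A + B < c ->
  gauss_value A B c = gamma_ratio A B c.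
Proof.
intros HA HB Hc.
assert (H : forall n, gauss_value A B c * gamma_ratio A B (c + INR n) =
  gamma_ratio A B c * gauss_value A B (c + INR n)).
{ intros n; induction n as [|n IH].
  - simpl; rewrite Rplus_0_r; ring.
  - rewrite S_INR, <- Rplus_assoc. pose proof (pos_INR n).
    pose proof (gauss_value_shift A B (c + INR n) HA HB ltac:(lra)) as E1.
    pose proof (gamma_ratio_shift A B (c + INR n) HA HB ltac:(lra)) as E2.
    set (s := (c + INR n - A) * (c + INR n - B)) in *.
    apply Rmult_eq_reg_l with s.
    2:{ apply Rgt_not_eq, Rmult_lt_0_compat; lra. }
    transitivity (gauss_value A B c * (s * gamma_ratio A B (c + INR n + 1)));
      [ring|].
    rewrite <- E2.
    transitivity ((c + INR n) * (c + INR n - A - B) *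
      (gamma_ratio A B c * gauss_value A B (c + INR n)));
      [rewrite <- IH; ring|].
    transitivity (gamma_ratio A B c *
      (s * gauss_value A B (c + INR n + 1))); [rewrite <- E1|]; ring. }
pose proof (is_lim_seq_mult' _ _ _ _ (is_lim_seq_const (gauss_value A B c))
  (gamma_ratio_lim A B c HA HB Hc)) as L1.
pose proof (is_lim_seq_mult' _ _ _ _ (is_lim_seq_const (gamma_ratio A B c))
  (gauss_value_lim A B c HA HB Hc)) as L2.
apply (is_lim_seq_ext _ _ _ H) in L1.
apply is_lim_seq_unique in L1; apply is_lim_seq_unique in L2.
rewrite L1 in L2; injection L2; lra.
Qed.

(** * The sums of the majorant *)

Definition hyper_series (A B c r : R) : R :=
  Series (fun k => negbin A k * (rising B k / rising c k) * (- r) ^ k).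

Definition clausen_sum (A B c : R) : R :=
  Series (fun m => negbin A m * pochratio B c (m + m)).

Definition clausen_mean (A B c : R) : R :=
  Series (fun m => / INR (S m) * (negbin A m * pochratio B c (m + m))).

Lemma gauss_sum_0 (A B c : R) :
  gauss_sum A (pochratio B c) 0 = gauss_value A B c.
Proof. apply Series_ext; intros j; rewrite Nat.add_0_r; reflexivity. Qed.

(** The derivative of (1 - x)^(1 - A) is (A - 1) (1 - x)^(-A). Read backwards, e_m / (m + 1) is a
    coefficient of index m + 1 for the parameter A - 1. *)
Lemma negbin_pred_S (A : R) (j : nat) :
  INR (S j) * negbin (A - 1) (S j) = (A - 1) * negbin A j.
Proof.
pose proof (rising_shift (A - 1) j) as E.
replace (A - 1 + 1) with A in E by ring.
unfold negbin; rewrite fact_simpl, mult_INR.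
change (rising (A - 1) (S j)) with (rising (A - 1) j * (A - 1 + INR j)).
rewrite <- E; field; split; [apply INR_fact_neq_0 | apply not_0_INR; lia].
Qed.

(** Since (1 - x)^(1 - A) = (1 - x)^(-A) - x (1 - x)^(-A), the series is the difference of the Gauss
    sums at k = 0 and k = 1, which [gauss_sum_S] relates. *)
Lemma gauss_sum_contiguous (A B c : R) : 0 < A -> 0 < B -> A + B < c ->
  (c - A) * Series (fun j => negbin (A - 1) j * pochratio B c j) =
  (c - A - B) * gauss_value A B c.
Proof.
intros HA HB Hc. pose proof (pochratio_weight A B c HA HB Hc) as HW.
assert (Hex : forall k, ex_series (fun j => negbin A j * pochratio B c (j + k)))
  by (intros k; apply (ex_gauss_sum _ _ _ _ _ k HW)).
pose proof (gauss_sum_S _ _ _ _ _ 0 HW) as E1.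
assert (H0 : ex_series (gauss_term A B c)) by (apply gauss_series; easy).
assert (Hs : forall j, negbin (A - 1) (S j) = negbin A (S j) - negbin A j).
{ intros j. apply Rmult_eq_reg_l with (INR (S j)); [|apply not_0_INR; lia].
  rewrite Rmult_minus_distr_l, negbin_pred_S, negbin_S, S_INR; ring. }
assert (E : is_series (fun j => negbin (A - 1) j * pochratio B c j)
  (gauss_value A B c - gauss_sum A (pochratio B c) 1)).
{ apply is_series_decr_1.
  apply is_series_Rext with (fun j => gauss_term A B c (S j) -
    negbin A j * pochratio B c (j + 1)).
  - intros j. rewrite Hs, Nat.add_1_r; unfold gauss_term; ring.
  - rewrite !negbin_0. change (is_series (fun j => gauss_term A B c (S j) -
    negbin A j * pochratio B c (j + 1)) (gauss_value A B c -
      gauss_sum A (pochratio B c) 1 + - (1 * (1 / 1)))).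
    replace (_ + _) with ((gauss_value A B c - 1) -
      gauss_sum A (pochratio B c) 1) by field.
    apply (is_series_minus (fun j => gauss_term A B c (S j))
      (fun j => negbin A j * pochratio B c (j + 1))).
    + unfold gauss_value; rewrite Series_incr_1 by exact H0.
      replace (gauss_term A B c 0) with 1
        by (unfold gauss_term, pochratio; rewrite negbin_0; simpl; field).
      replace (1 + _ - 1) with (Series (fun j => gauss_term A B c (S j)))
        by ring.
      apply Series_correct, (ex_series_incr_1 (gauss_term A B c)), H0.
    + apply Series_correct, Hex. }
rewrite (is_series_unique _ _ E).
rewrite gauss_sum_0 in E1; simpl INR in E1; lra.
Qed.

Definition lowered_weight (B c : R) (n : nat) : R :=
  match n with
  | O => (c - 1) * (c - 2)
  | S O => (c - 1) * (B - 2)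
  | S (S m) => (B - 2) * (B - 1) * pochratio B c m
  end.

(** The left side is |A - 1| e_(j+1) for the parameter A, and e_(j+1) <= (A + 1) e_j because (A + j)
    / (j + 1) <= A + 1. *)
Lemma negbin_pred_SS_le (A : R) (j : nat) : 0 < A ->
  INR (S (S j)) * Rabs (negbin (A - 1) (S (S j)))
  <= Rabs (A - 1) * (A + 1) * negbin A j.
Proof.
intros HA. pose proof (negbin_pos A j HA) as Hp; pose proof (pos_INR j) as Hj.
rewrite <- (Rabs_pos_eq (INR (S (S j)))) by apply pos_INR.
rewrite <- Rabs_mult, negbin_pred_S, Rabs_mult, Rmult_assoc.
apply Rmult_le_compat_l; [apply Rabs_pos|].
rewrite Rabs_pos_eq by (apply Rlt_le, negbin_pos, HA).
apply Rmult_le_reg_l with (INR (S j)); [rewrite S_INR; lra|].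
rewrite negbin_S, <- Rmult_assoc. apply Rmult_le_compat_r; [lra|].
rewrite S_INR; nra.
Qed.

Lemma lowered_weight_hyper (A B c : R) : 0 < A -> 0 < B -> A + B < c ->
  exists V, hyper_weight (A - 1) (B - 2) (c - 2) (lowered_weight B c) V.
Proof.
intros HA HB Hc.
set (D := Rabs ((B - 2) * (B - 1))).
set (M := Rabs ((c - 1) * (c - 2)) + Rabs ((c - 1) * (B - 2)) + D).
assert (HD : 0 <= D) by apply Rabs_pos.
(* From index 2 on the weights are a multiple of the nonincreasing [pochratio B c]. The two initial
   values need not fit that pattern, so V is the global bound [M] there. *)
exists (fun n => match n with
                 | O => M | S O => M | S (S m) => D * pochratio B c m end).
destruct (gauss_series A B c HA HB Hc) as [Hs _].
assert (Hw : forall n, 0 < pochratio B c n)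
  by (intros; apply pochratio_pos; lra).
assert (Hw1 : forall n, pochratio B c n <= 1).
{ intros n. replace 1 with (pochratio B c 0) by (unfold pochratio; simpl; field).
  apply (pochratio_decr B c 0 n); lra. }
assert (HWD : forall m, Rabs (lowered_weight B c (S (S m))) <=
  D * pochratio B c m).
{ intros m; simpl; rewrite Rabs_mult, (Rabs_pos_eq (pochratio _ _ _))
    by apply Rlt_le, Hw; unfold D; lra. }
assert (HWM : forall n, Rabs (lowered_weight B c n) <= M).
{ intros n; pose proof (Rabs_pos ((c - 1) * (c - 2)));
  pose proof (Rabs_pos ((c - 1) * (B - 2))).
  destruct n as [|[|m]]; [simpl; unfold M; lra .. |].
  apply Rle_trans with (1 := HWD m). specialize (Hw1 m); specialize (Hw m).
  unfold M; nra. }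
repeat split.
- intros n; destruct n as [|[|m]].
  + simpl; ring.
  + unfold lowered_weight, pochratio; simpl; field.
  + pose proof (pochratio_S B c m ltac:(lra)) as E. rewrite !S_INR.
    simpl lowered_weight.
    transitivity ((B - 2) * (B - 1) *
      ((c + INR m) * pochratio B c (S m))); [ring|rewrite E; ring].
- intros n k; destruct n as [|[|m]]; [apply HWM .. |].
  apply Rle_trans with (1 := HWD (m + k)%nat).
  apply Rmult_le_compat_l; [exact HD|]. apply pochratio_decr; lra.
- apply (ex_series_incr_n (fun j => Rabs (negbin (A - 1) j) *
    match j with O => M | S O => M | S (S m) => D * pochratio B c m end) 2).
  apply ex_series_dominated with (fun j =>
    Rabs (A - 1) * (A + 1) * D * gauss_term A B c j);
    [|apply ex_series_Rmult, Hs].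
  intros j; change (Rabs (Rabs (negbin (A - 1) (S (S j))) *
    (D * pochratio B c j)) <=
    Rabs (A - 1) * (A + 1) * D * gauss_term A B c j).
  specialize (Hw j).
  pose proof (negbin_pred_SS_le A j HA) as H1.
  pose proof (pos_INR j). pose proof (Rabs_pos (negbin (A - 1) (S (S j)))).
  assert (H2 : Rabs (negbin (A - 1) (S (S j))) <=
    Rabs (A - 1) * (A + 1) * negbin A j).
  { apply Rle_trans with (2 := H1). rewrite !S_INR. nra. }
  rewrite Rabs_mult, Rabs_Rabsolu, (Rabs_pos_eq (D * _)) by nra.
  unfold gauss_term.
  replace (Rabs (A - 1) * (A + 1) * D * (negbin A j * pochratio B c j)) with
    (Rabs (A - 1) * (A + 1) * negbin A j * (D * pochratio B c j)) by ring.
  apply Rmult_le_compat_r; [nra | exact H2].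
(* Lowering A to A - 1 absorbs the factor j, so convergence of [gauss_term A B c] to 0 is enough. *)
- intros k. apply is_lim_seq_abs_0.
  apply (is_lim_seq_incr_n _ 2).
  apply is_lim_seq_le_le with (fun _ => 0)
    (fun j => Rabs (A - 1) * (A + 1) * D * gauss_term A B c j).
  + intros j; split; [apply Rabs_pos|].
    replace (j + 2)%nat with (S (S j)) by lia.
    rewrite !Rabs_mult, (Rabs_pos_eq (INR _)) by apply pos_INR.
    pose proof (negbin_pred_SS_le A j HA) as H1.
    replace (Rabs (A - 1) * (A + 1) * D * gauss_term A B c j) with
      (Rabs (A - 1) * (A + 1) * negbin A j * (D * pochratio B c j))
      by (unfold gauss_term; ring).
    apply Rmult_le_compat; [|apply Rabs_pos|exact H1|].
    * apply Rmult_le_pos; [apply pos_INR | apply Rabs_pos].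
    * apply Rle_trans with (1 := HWD (j + k)%nat).
      apply Rmult_le_compat_l; [exact HD|]. apply pochratio_decr; lra.
  + apply is_lim_seq_const.
  + replace (Finite 0) with (Finite (Rabs (A - 1) * (A + 1) * D * 0))
      by (f_equal; ring).
    apply is_lim_seq_mult'; [apply is_lim_seq_const|].
    apply ex_series_lim_0, Hs.
Qed.

(** Two steps of [gauss_sum_S] lead from k = 0 to k = 2, where the lowered weights are (B - 2) (B -
    1) [pochratio B c] and [gauss_sum_contiguous] applies. The factor (B - 2) (B - 1) then
    cancels. *)
Lemma lowered_gauss_sum (A B c : R) : 0 < A -> 0 < B -> A + B < c ->
  B <> 1 -> B <> 2 ->
  gauss_sum (A - 1) (lowered_weight B c) 0 =
  (c - A - 1) * (c - A - B) * gauss_value A B c.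
Proof.
intros HA HB Hc HB1 HB2.
destruct (lowered_weight_hyper A B c HA HB Hc) as [V HV].
pose proof (gauss_sum_S _ _ _ _ _ 0 HV) as E0.
pose proof (gauss_sum_S _ _ _ _ _ 1 HV) as E1.
assert (E2 : gauss_sum (A - 1) (lowered_weight B c) 2 = (B - 2) * (B - 1) *
  Series (fun j => negbin (A - 1) j * pochratio B c j)).
{ unfold gauss_sum; rewrite <- Series_scal_l; apply Series_ext; intros j.
  replace (j + 2)%nat with (S (S j)) by lia; simpl lowered_weight; ring. }
pose proof (gauss_sum_contiguous A B c HA HB Hc) as E3.
rewrite E2 in E1; simpl INR in *.
set (g0 := gauss_sum (A - 1) (lowered_weight B c) 0) in *.
set (g1 := gauss_sum (A - 1) (lowered_weight B c) 1) in *.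
set (s := Series _) in *.
apply Rmult_eq_reg_l with ((B - 2) * (B - 1));
  [|apply Rmult_integral_contrapositive; split; lra].
transitivity ((B - 1) * ((B - 2 + 0) * g0)); [ring|]. rewrite <- E0.
transitivity ((c - A - 1) * ((B - 2 + 1) * g1)); [ring|]. rewrite <- E1.
transitivity ((c - A - 1) * (B - 2) * (B - 1) * ((c - A) * s)); [ring|].
rewrite E3; ring.
Qed.

Lemma ex_clausen_sum (A B c : R) : 0 < A -> 0 < B -> A + B < c ->
  ex_series (fun m => negbin A m * pochratio B c (m + m)).
Proof.
intros HA HB Hc; destruct (gauss_series A B c HA HB Hc) as [Hs _].
apply ex_series_dominated with (2 := Hs); intros m.
pose proof (negbin_pos A m HA).
pose proof (pochratio_pos B c (m + m) HB ltac:(lra)).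
rewrite Rabs_pos_eq by (apply Rmult_le_pos; lra).
apply Rmult_le_compat_l; [lra|]. apply pochratio_decr; lra.
Qed.

Lemma ex_clausen_mean (A B c : R) : 0 < A -> 0 < B -> A + B < c ->
  ex_series (fun m => / INR (S m) * (negbin A m * pochratio B c (m + m))).
Proof.
intros HA HB Hc.
apply ex_series_dominated with (2 := ex_clausen_sum A B c HA HB Hc).
intros m; pose proof (negbin_pos A m HA).
pose proof (pochratio_pos B c (m + m) HB ltac:(lra)).
pose proof (pos_INR m). rewrite Rabs_mult, (Rabs_pos_eq (_ * _)) by nra.
rewrite <- (Rmult_1_l (negbin A m * _)) at 2.
apply Rmult_le_compat_r; [nra|]. rewrite S_INR.
rewrite Rabs_pos_eq by (apply Rlt_le, Rinv_0_lt_compat; lra).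
rewrite <- Rinv_1; apply Rinv_le_contravar; lra.
Qed.

Lemma clausen_sum_gauss (A B c l : R) (r : nat -> R) :
  0 < A -> 0 < B -> A + B < c ->
  (forall n, 0 <= r n < 1) -> is_lim_seq r 1 ->
  is_lim_seq (fun n => hyper_series A B (c - A) (r n)) l ->
  clausen_sum A B c = gamma_ratio A B c * l.
Proof.
intros HA HB Hc Hr Hr1 Hl.
pose proof (abel_limit _ _ _ _ _ r (pochratio_weight A B c HA HB Hc)
  ltac:(lra) Hr Hr1) as H1.
pose proof (is_lim_seq_mult' _ _ _ _
  (is_lim_seq_const (gamma_ratio A B c)) Hl) as H2.
rewrite gauss_sum_0, gauss_summation in H1 by easy.
apply is_lim_seq_unique in H1; apply is_lim_seq_unique in H2.
unfold hyper_series in H2; rewrite H1 in H2; injection H2; easy.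
Qed.

(** In the lowered series, index 0 contributes (c - 1) (c - 2), and by [negbin_pred_S] index m + 1
    contributes (A - 1) (B - 1) (B - 2) T_m / (m + 1). *)
Lemma clausen_mean_gauss (A B c l : R) (r : nat -> R) :
  0 < A -> 0 < B -> A + B < c -> A + 1 < c -> B <> 1 -> B <> 2 ->
  (forall n, 0 <= r n < 1) -> is_lim_seq r 1 ->
  is_lim_seq (fun n => hyper_series (A - 1) (B - 2) (c - A - 1) (r n)) l ->
  (c - 1) * (c - 2) + (A - 1) * (B - 1) * (B - 2) * clausen_mean A B c =
  (c - A - B) * (c - A - 1) * gamma_ratio A B c * l.
Proof.
intros HA HB Hc HcA HB1 HB2 Hr Hr1 Hl.
destruct (lowered_weight_hyper A B c HA HB Hc) as [V HV].
pose proof (abel_limit _ _ _ _ _ r HV ltac:(lra) Hr Hr1) as H1.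
pose proof (is_lim_seq_mult' _ _ _ _ (is_lim_seq_const
  ((c - A - B) * (c - A - 1) * gamma_ratio A B c)) Hl) as H2.
rewrite lowered_gauss_sum, gauss_summation in H1 by easy.
replace (c - 2 - (A - 1)) with (c - A - 1) in H1 by ring.
replace ((c - A - 1) * (c - A - B) * gamma_ratio A B c) with
  ((c - A - B) * (c - A - 1) * gamma_ratio A B c) in H1 by ring.
apply is_lim_seq_unique in H1; apply is_lim_seq_unique in H2.
unfold hyper_series in H2; rewrite H1 in H2; injection H2; intros E.
rewrite <- E. clear - HA HB Hc.
symmetry; apply is_series_unique, is_series_decr_1.
apply is_series_Rext with (fun m => (A - 1) * (B - 1) * (B - 2) *
  (/ INR (S m) * (negbin A m * pochratio B c (m + m)))).
- intros m. rewrite Nat.add_succ_r; simpl lowered_weight.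
  replace (negbin (A - 1) (S m)) with ((A - 1) * negbin A m / INR (S m)).
  + field; apply not_0_INR; lia.
  + rewrite <- negbin_pred_S; field; apply not_0_INR; lia.
- rewrite negbin_0. simpl lowered_weight.
  change (is_series (fun m => (A - 1) * (B - 1) * (B - 2) *
    (/ INR (S m) * (negbin A m * pochratio B c (m + m))))
    ((c - 1) * (c - 2) + (A - 1) * (B - 1) * (B - 2) * clausen_mean A B c
      + - (1 * ((c - 1) * (c - 2))))).
  replace (_ + _ + _) with
    ((A - 1) * (B - 1) * (B - 2) * clausen_mean A B c) by ring.
  apply (is_series_Rmult ((A - 1) * (B - 1) * (B - 2))).
  apply Series_correct, ex_clausen_mean; easy.
Qed.

(** The numerical hypothesis translated into a bound on a series: the two closed forms are combined
    with weights 1 and lambda - 1, and the summand with (c - 1) (c - 2) moves to the left side. *)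
Lemma clausen_weighted_le (A B c lambda X l1 l2 : R) (r : nat -> R) :
  0 < A -> 0 < B -> A + B < c -> A + 1 < c -> A <> 1 -> B <> 1 -> B <> 2 ->
  (forall n, 0 <= r n < 1) -> is_lim_seq r 1 ->
  is_lim_seq (fun n => hyper_series (A - 1) (B - 2) (c - A - 1) (r n)) l1 ->
  is_lim_seq (fun n => hyper_series A B (c - A) (r n)) l2 ->
  gamma_ratio A B c * ((lambda - 1) * (c - A - B) * (c - A - 1) /
    ((A - 1) * (B - 1) * (B - 2)) * l1 + l2)
  <= X + (lambda - 1) * (c - 1) * (c - 2) / ((A - 1) * (B - 1) * (B - 2)) ->
  ex_series (fun m => (1 + (lambda - 1) * / INR (S m)) *
    (negbin A m * pochratio B c (m + m))) /\
  Series (fun m => (1 + (lambda - 1) * / INR (S m)) *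
    (negbin A m * pochratio B c (m + m))) <= X.
Proof.
intros HA HB Hc HcA HA1 HB1 HB2 Hr Hr1 Hl1 Hl2 Hineq.
pose proof (clausen_sum_gauss A B c l2 r HA HB Hc Hr Hr1 Hl2) as E1.
pose proof (clausen_mean_gauss A B c l1 r HA HB Hc HcA HB1 HB2 Hr Hr1 Hl1)
  as E2.
assert (E : is_series (fun m => (1 + (lambda - 1) * / INR (S m)) *
    (negbin A m * pochratio B c (m + m)))
    (clausen_sum A B c + (lambda - 1) * clausen_mean A B c)).
{ apply is_series_Rext with (fun m => negbin A m * pochratio B c (m + m) +
    (lambda - 1) * (/ INR (S m) * (negbin A m * pochratio B c (m + m)))).
  - intros m; ring.
  - apply (is_series_plus (fun m => negbin A m * pochratio B c (m + m))
      (fun m => (lambda - 1) *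
        (/ INR (S m) * (negbin A m * pochratio B c (m + m))))).
    + apply Series_correct, ex_clausen_sum; easy.
    + apply (is_series_Rmult (lambda - 1)), Series_correct, ex_clausen_mean;
        easy. }
split; [eexists; exact E|]. rewrite (is_series_unique _ _ E).
rewrite E1.
replace (clausen_mean A B c) with
  (((c - A - B) * (c - A - 1) * gamma_ratio A B c * l1 - (c - 1) * (c - 2)) /
   ((A - 1) * (B - 1) * (B - 2))) by (rewrite <- E2; field; lra).
match goal with |- ?g <= X => replace g with
  (gamma_ratio A B c * ((lambda - 1) * (c - A - B) * (c - A - 1) /
    ((A - 1) * (B - 1) * (B - 2)) * l1 + l2) -
   (lambda - 1) * (c - 1) * (c - 2) / ((A - 1) * (B - 1) * (B - 2)))
   by (field; lra) end.
lra.
Qed.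

(** * Complex power series *)

Lemma pow_n_Cpow (z : C) (n : nat) : pow_n z n = (z ^ n)%C.
Proof. induction n as [|n IH]; [reflexivity|]. simpl; rewrite IH; reflexivity. Qed.

Lemma is_pseries_Cpow (u : nat -> C) (z l : C) :
  is_pseries u z l <-> is_series (fun n => (z ^ n * u n)%C) l.
Proof.
unfold is_pseries; split; intros H;
  eapply is_series_ext; try exact H; intros n;
  [|symmetry]; exact (f_equal (fun p => (p * u n)%C) (pow_n_Cpow z n)).
Qed.

(** Bridges the uniform structure carried by [C_UniformSpace] and epsilon estimates in [Cmod]. *)
Lemma C_filterlim_iff (s : nat -> C) (l : C) :
  filterlim s eventually (locally (T := C_UniformSpace) l) <->
  forall eps, 0 < eps ->
    exists N, forall n, (N <= n)%nat -> Cmod (s n - l) < eps.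
Proof.
split; intros H.
- intros e He.
  destruct (H (fun y : C => Cmod (y - l) < e)) as [N HN].
  + apply (locally_le_locally_norm (V := C_NormedModule)).
    exists (mkposreal e He); intros y Hy; exact Hy.
  + exists N; exact HN.
- intros P HP.
  apply (locally_norm_le_locally (V := C_NormedModule)) in HP.
  destruct HP as [e He].
  destruct (H e (cond_pos e)) as [N HN].
  exists N; intros n Hn; apply He. apply HN, Hn.
Qed.

Lemma is_series_C_iff (a : nat -> C) (l : C) :
  is_series a l <-> forall eps, 0 < eps ->
    exists N, forall n, (N <= n)%nat -> Cmod (sum_n a n - l) < eps.
Proof. apply C_filterlim_iff. Qed.

Lemma sum_n_Re (a : nat -> C) (n : nat) :
  Re (sum_n a n) = sum_f_R0 (fun k => Re (a k)) n.
Proof.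
induction n as [|n IH]; [rewrite sum_O; reflexivity|].
rewrite sum_Sn, tech5, <- IH; reflexivity.
Qed.

Lemma is_series_Re (a : nat -> C) (l : C) :
  is_series a l -> is_series (fun n => Re (a n)) (Re l).
Proof.
intros H; rewrite is_series_C_iff in H.
apply is_series_iff_lim, is_lim_seq_spec; intros [e He].
destruct (H e He) as [N HN]; exists N; intros n Hn; simpl.
rewrite <- sum_n_Re. apply Rle_lt_trans with (2 := HN n Hn).
apply Rle_trans with (2 := re_le_Cmod _). right; reflexivity.
Qed.

Lemma is_Cseries_scal (c : C) (a : nat -> C) (l : C) :
  is_series a l -> is_series (fun n => (c * a n)%C) (c * l)%C.
Proof. exact (is_series_scal c a l). Qed.

Lemma is_Cseries_minus (a b : nat -> C) (la lb : C) :
  is_series a la -> is_series b lb ->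
  is_series (fun n => (a n - b n)%C) (la - lb)%C.
Proof. exact (is_series_minus a b la lb). Qed.

Lemma is_Cseries_ext (a b : nat -> C) (l : C) :
  (forall n, a n = b n) -> is_series a l -> is_series b l.
Proof. exact (is_series_ext a b l). Qed.

Lemma is_Cseries_tail (a : nat -> C) (l : C) :
  is_series a l -> is_series (fun n => a (S n)) (l - a O)%C.
Proof.
intros H. apply (is_series_incr_1 a).
change (is_series a (l - a O + a O)%C).
replace (l - a O + a O)%C with l by ring. exact H.
Qed.

Lemma is_Cseries_unique (a : nat -> C) (l l' : C) :
  is_series a l -> is_series a l' -> l = l'.
Proof. exact (filterlim_locally_unique (sum_n a) l l'). Qed.

Lemma ex_Cseries_dominated (a : nat -> C) (M : nat -> R) :
  (forall n, Cmod (a n) <= M n) -> ex_series M -> exists l : C, is_series a l.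
Proof. intros H HM; exact (ex_series_le a M H HM). Qed.

Lemma sum_n_Cmod_le (a : nat -> C) (M : nat -> R) (n : nat) :
  (forall n, Cmod (a n) <= M n) -> Cmod (sum_n a n) <= sum_f_R0 M n.
Proof.
intros H; induction n as [|n IH]; [rewrite sum_O; apply H|].
rewrite sum_Sn, tech5.
apply Rle_trans with (1 := Cmod_triangle _ _).
apply Rplus_le_compat; [exact IH | apply H].
Qed.

Lemma Cseries_mod_le (a : nat -> C) (l : C) (M : nat -> R) :
  is_series a l -> (forall n, Cmod (a n) <= M n) -> ex_series M ->
  Cmod l <= Series M.
Proof.
intros Hl HM Hex; rewrite is_series_C_iff in Hl.
apply le_epsilon; intros e He. destruct (Hl e He) as [N HN].
specialize (HN N (Nat.le_refl N)).
pose proof (sum_n_Cmod_le a M N HM) as H1.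
assert (H2 : sum_f_R0 M N <= Series M).
{ apply sum_le_Series; [|exact Hex].
  intros n; apply Rle_trans with (2 := HM n), Cmod_ge_0. }
replace l with (sum_n a N + - (sum_n a N - l))%C by ring.
apply Rle_trans with (1 := Cmod_triangle _ _). rewrite Cmod_opp. lra.
Qed.

Lemma Cseries_terms_bounded (a : nat -> C) (l : C) :
  is_series a l -> exists K, forall n, Cmod (a n) <= K.
Proof.
intros H; rewrite is_series_C_iff in H. destruct (H 1 Rlt_0_1) as [N HN].
exists (sum_f_R0 (fun k => Cmod (a k)) N + 2); intros n.
destruct (Nat.le_gt_cases n N) as [Hn|Hn].
- enough (Cmod (a n) <= sum_f_R0 (fun k => Cmod (a k)) N) by lra.
  clear HN; induction Hn as [|N Hn IH].
  + destruct n as [|n]; [simpl; lra|]. rewrite tech5.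
    pose proof (cond_pos_sum (fun k => Cmod (a k)) n
      (fun k => Cmod_ge_0 (a k))); lra.
  + rewrite tech5; pose proof (Cmod_ge_0 (a (S N))); lra.
- destruct n as [|n]; [lia|].
  pose proof (HN n ltac:(lia)) as H1. pose proof (HN (S n) ltac:(lia)) as H2.
  rewrite sum_Sn in H2.
  assert (Cmod (a (S n)) < 2).
  { replace (a (S n)) with ((plus (sum_n a n) (a (S n)) - l)
      + - (sum_n a n - l))%C.
    - apply Rle_lt_trans with (1 := Cmod_triangle _ _).
      rewrite Cmod_opp; lra.
    - change (plus (sum_n a n) (a (S n))) with (sum_n a n + a (S n))%C.
      ring. }
  pose proof (cond_pos_sum (fun k => Cmod (a k)) N
      (fun k => Cmod_ge_0 (a k))); lra.
Qed.

Lemma Cmod_RtoC (x : R) : 0 <= x -> Cmod (RtoC x) = x.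
Proof. intros H; rewrite Cmod_R; apply Rabs_pos_eq, H. Qed.

(** Convergence at a point [s] between rho and 1 bounds |u_n| s^n, leaving a geometric factor (rho /
    s)^n. The polynomial factor is absorbed by 2 [negbin 3 n] = (n + 1) (n + 2). The square is what
    the second-order remainder below consumes. *)
Lemma disk_coeff_summable (f : C -> C) (u : nat -> C) (rho : R) :
  expands_as f u -> 0 <= rho < 1 ->
  ex_series (fun n => INR (S n) ^ 2 * (Cmod (u n) * rho ^ n)).
Proof.
intros Hf Hr. set (s := (1 + rho) / 2).
assert (Hs : 0 < s < 1) by (unfold s; lra).
specialize (Hf (RtoC s)). unfold unit_disk in Hf.
rewrite Cmod_RtoC in Hf by lra. specialize (Hf (proj2 Hs)).
rewrite is_pseries_Cpow in Hf.
destruct (Cseries_terms_bounded _ _ Hf) as [K HK].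
assert (HK0 : 0 <= K) by (apply Rle_trans with (2 := HK O), Cmod_ge_0).
apply ex_series_dominated with
  (fun n => 2 * K * (Rabs (negbin 3 n) * (rho / s) ^ n)).
- intros n. specialize (HK n).
  rewrite Cmod_mult, Cmod_pow, Cmod_RtoC in HK by lra.
  assert (Hn : INR (S n) ^ 2 <= 2 * negbin 3 n).
  { replace (2 * negbin 3 n) with (INR (S n) * INR (S (S n))).
    - replace (INR (S n) ^ 2) with (INR (S n) * INR (S n)) by ring.
      apply Rmult_le_compat_l; [apply pos_INR|].
      apply le_INR; lia.
    - clear; induction n as [|n IH]; [rewrite negbin_0; simpl; lra|].
      apply Rmult_eq_reg_l with (INR (S n)); [|apply not_0_INR; lia].
      replace (INR (S n) * (2 * negbin 3 (S n))) with
        (2 * (INR (S n) * negbin 3 (S n))) by ring.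
      rewrite negbin_S.
      replace (2 * ((3 + INR n) * negbin 3 n)) with
        ((3 + INR n) * (2 * negbin 3 n)) by ring.
      rewrite <- IH, !S_INR; ring. }
  rewrite (Rabs_pos_eq (negbin 3 n)) by (apply Rlt_le, negbin_pos; lra).
  pose proof (pow_lt s n (proj1 Hs)) as Hsn.
  pose proof (pow_le rho n (proj1 Hr)) as Hrn.
  pose proof (Cmod_ge_0 (u n)).
  rewrite Rabs_pos_eq.
  2:{ apply Rmult_le_pos; [apply pow2_ge_0 | apply Rmult_le_pos; lra]. }
  replace (2 * K * (negbin 3 n * (rho / s) ^ n)) with
    ((2 * negbin 3 n) * (K * (rho / s) ^ n)) by ring.
  apply Rmult_le_compat; [apply pow2_ge_0 | nra | exact Hn |].
  unfold Rdiv; rewrite Rpow_mult_distr, pow_inv.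
  apply Rmult_le_reg_r with (1 := Hsn).
  replace (K * (rho ^ n * / s ^ n) * s ^ n) with (K * rho ^ n) by (field; lra).
  replace (Cmod (u n) * rho ^ n * s ^ n) with
    (s ^ n * Cmod (u n) * rho ^ n) by ring.
  apply Rmult_le_compat_r; lra.
- apply ex_series_Rmult, ex_series_negbin_pow; split.
  + apply Rmult_le_pos; [lra | apply Rlt_le, Rinv_0_lt_compat; lra].
  + apply Rmult_lt_reg_r with s; [lra|]. unfold Rdiv.
    rewrite Rmult_assoc, Rinv_l by lra. unfold s; lra.
Qed.

Definition deriv_coeff (u : nat -> C) (n : nat) : C :=
  (INR (S n) * u (S n))%C.

(** If E_n is the remainder, then E_(n+1) = w E_n + (n + 1) (w - z)^2 z^n. The factor [rho] on the
    left avoids the exponent n - 1, which would be wrong for natural numbers at n = 0. *)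
Lemma Cpow_second_order (z w : C) (rho : R) (n : nat) :
  0 < rho -> Cmod z <= rho -> Cmod w <= rho ->
  rho * Cmod (w ^ S n - z ^ S n - INR (S n) * ((w - z) * z ^ n)) <=
  Cmod (w - z) ^ 2 * (INR (S n) ^ 2 * rho ^ n).
Proof.
intros Hr Hz Hw. set (d := Cmod (w - z)).
assert (Hd : 0 <= d) by apply Cmod_ge_0.
induction n as [|n IH].
- replace (w ^ 1 - z ^ 1 - INR 1 * ((w - z) * z ^ 0))%C with (RtoC 0)
    by (simpl; ring).
  rewrite Cmod_0. simpl; nra.
- set (E := (w ^ S n - z ^ S n - INR (S n) * ((w - z) * z ^ n))%C) in *.
  replace (w ^ S (S n) - z ^ S (S n) - INR (S (S n)) * ((w - z) * z ^ S n))%C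
    with (w * E + INR (S n) * ((w - z) ^ 2 * z ^ n))%C.
  2:{ unfold E; rewrite (S_INR (S n)), RtoC_plus; simpl; ring. }
  apply Rle_trans with (rho * (rho * Cmod E +
    INR (S n) * (d ^ 2 * rho ^ n))).
  + apply Rmult_le_compat_l; [lra|].
    apply Rle_trans with (1 := Cmod_triangle _ _).
    rewrite !Cmod_mult, !Cmod_pow, (Cmod_RtoC (INR (S n))) by apply pos_INR.
    fold d. pose proof (Cmod_ge_0 E).
    apply Rplus_le_compat; [apply Rmult_le_compat_r; lra|].
    apply Rmult_le_compat_l; [apply pos_INR|].
    apply Rmult_le_compat_l; [apply pow2_ge_0|].
    apply pow_incr; split; [apply Cmod_ge_0 | exact Hz].
  + pose proof (pow_lt rho n Hr) as Hp. pose proof (pos_INR n) as Hn.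
    apply Rle_trans with (rho * (d ^ 2 * (INR (S n) ^ 2 * rho ^ n) +
      INR (S n) * (d ^ 2 * rho ^ n))); [apply Rmult_le_compat_l; lra|].
    replace (rho * _) with (d ^ 2 * ((INR (S n) ^ 2 + INR (S n)) *
      (rho * rho ^ n))) by ring.
    apply Rmult_le_compat_l; [apply pow2_ge_0|].
    apply Rmult_le_compat_r; [apply (pow_le rho (S n)); lra|].
    rewrite !S_INR; nra.
Qed.

Lemma is_derive_C_intro (f : C -> C) (z l : C) (delta K : R) :
  0 < delta -> 0 <= K ->
  (forall w, Cmod (w - z) < delta ->
    Cmod (f w - f z - (w - z) * l) <= K * Cmod (w - z) ^ 2) ->
  is_derive f z l.
Proof.
intros Hd HK H; split; [apply is_linear_scal_l|].
intros x Hx. rewrite <- (is_filter_lim_locally_unique _ _ Hx).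
intros [e He].
assert (Hm : 0 < Rmin delta (e / (K + 1))).
{ apply Rmin_glb_lt; [exact Hd | apply Rdiv_lt_0_compat; lra]. }
exists (mkposreal _ Hm); intros w Hw.
change (Cmod (w - z) < Rmin delta (e / (K + 1))) in Hw.
change (Cmod (f w - f z - (w - z) * l) <= e * Cmod (w - z)).
pose proof (Rmin_l delta (e / (K + 1))).
pose proof (Rmin_r delta (e / (K + 1))).
apply Rle_trans with (1 := H w ltac:(lra)).
pose proof (Cmod_ge_0 (w - z)) as Hwz.
simpl; rewrite Rmult_1_r, <- Rmult_assoc.
apply Rmult_le_compat_r; [exact Hwz|].
assert (H2 : (K + 1) * Cmod (w - z) <= (K + 1) * (e / (K + 1)))
  by (apply Rmult_le_compat_l; lra).
replace ((K + 1) * (e / (K + 1))) with e in H2 by (field; lra). nra.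
Qed.

(** Termwise differentiation through a uniform quadratic remainder. With [rho] halfway between |z|
    and 1, every w closer to z than (1 - |z|) / 2 stays in the disk of radius [rho], where the
    remainders of the powers have a summable bound. *)
Lemma expands_as_derive (f : C -> C) (u : nat -> C) (z : C) :
  expands_as f u -> unit_disk z ->
  is_derive f z (C_derive f z) /\ is_pseries (deriv_coeff u) z (C_derive f z).
Proof.
intros Hf Hz. unfold unit_disk in Hz.
set (rho := (1 + Cmod z) / 2). pose proof (Cmod_ge_0 z) as Hz0.
assert (Hrho : 0 < rho < 1) by (unfold rho; lra).
pose proof (disk_coeff_summable f u rho Hf ltac:(lra)) as HS.
set (M := fun n => INR (S n) ^ 2 * (Cmod (u (S n)) * rho ^ n)).
assert (HM : ex_series M).
{ apply (ex_series_incr_1 _) in HS.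
  apply ex_series_dominated with
    (fun n => / rho * (INR (S (S n)) ^ 2 * (Cmod (u (S n)) * rho ^ S n))).
  - intros n; unfold M. pose proof (Cmod_ge_0 (u (S n))).
    pose proof (pow_lt rho n (proj1 Hrho)).
    rewrite Rabs_pos_eq by (apply Rmult_le_pos;
      [apply pow2_ge_0 | apply Rmult_le_pos; lra]).
    replace (/ rho * (INR (S (S n)) ^ 2 * (Cmod (u (S n)) * rho ^ S n)))
      with (INR (S (S n)) ^ 2 * (Cmod (u (S n)) * rho ^ n))
      by (simpl pow; field; lra).
    apply Rmult_le_compat_r; [apply Rmult_le_pos; lra|].
    apply pow_incr; split; [apply pos_INR | apply le_INR; lia].
  - apply (ex_series_Rmult (/ rho)), HS. }
assert (Hl : exists l : C, is_series (fun n => (z ^ n * deriv_coeff u n)%C) l).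
{ apply ex_Cseries_dominated with M; [|exact HM]. intros n.
  unfold M, deriv_coeff.
  rewrite !Cmod_mult, Cmod_pow, Cmod_RtoC by apply pos_INR.
  assert (H1 : Cmod z ^ n <= rho ^ n)
    by (apply pow_incr; unfold rho; lra).
  assert (H2 : 1 <= INR (S n)) by (rewrite S_INR; pose proof (pos_INR n); lra).
  pose proof (Cmod_ge_0 (u (S n))). pose proof (pow_le (Cmod z) n Hz0).
  replace (Cmod z ^ n * (INR (S n) * Cmod (u (S n)))) with
    (INR (S n) * (Cmod (u (S n)) * Cmod z ^ n)) by ring.
  apply Rmult_le_compat; [lra | apply Rmult_le_pos; lra | |].
  - rewrite <- Rsqr_pow2; unfold Rsqr; nra.
  - apply Rmult_le_compat_l; lra. }
destruct Hl as [l Hl].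
assert (Hd : is_derive f z l).
{ apply is_derive_C_intro with ((1 - Cmod z) / 2) (/ rho * Series M).
  - lra.
  - apply Rmult_le_pos; [apply Rlt_le, Rinv_0_lt_compat; lra|].
    apply Rle_trans with (sum_f_R0 M 0).
    + unfold M; simpl. pose proof (Cmod_ge_0 (u 1%nat)); nra.
    + apply sum_le_Series; [|exact HM]. intros n; unfold M.
      apply Rmult_le_pos; [apply pow2_ge_0|].
      apply Rmult_le_pos; [apply Cmod_ge_0 | apply pow_le; lra].
  - intros w Hw.
    assert (Hwr : Cmod w <= rho).
    { replace w with (z + (w - z))%C by ring.
      apply Rle_trans with (1 := Cmod_triangle _ _). unfold rho; lra. }
    assert (H1 := proj1 (is_pseries_Cpow _ _ _) (Hf z Hz)).
    assert (Hw1 : unit_disk w) by (unfold unit_disk; lra).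
    assert (H2 := proj1 (is_pseries_Cpow _ _ _) (Hf w Hw1)).
    pose proof (is_Cseries_tail _ _ (is_Cseries_minus _ _ _ _ H2 H1)) as H3.
    pose proof (is_Cseries_minus _ _ _ _ H3 (is_Cseries_scal (w - z) _ _ Hl))
      as H4.
    replace (f w - f z - (w - z) * l)%C with
      (f w - f z - (w ^ 0 * u O - z ^ 0 * u O) - (w - z) * l)%C
      by (simpl; ring).
    replace (/ rho * Series M * Cmod (w - z) ^ 2) with
      (Series (fun n => / rho * Cmod (w - z) ^ 2 * M n))
      by (rewrite Series_scal_l; ring).
    apply (Cseries_mod_le _ _ _ H4); [|apply ex_series_Rmult, HM].
    intros n; cbv beta.
    pose proof (Cpow_second_order z w rho n (proj1 Hrho)
      ltac:(unfold rho; lra) Hwr) as H5.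
    replace (w ^ S n * u (S n) - z ^ S n * u (S n) -
      (w - z) * (z ^ n * deriv_coeff u n))%C with
      ((w ^ S n - z ^ S n - INR (S n) * ((w - z) * z ^ n)) * u (S n))%C
      by (unfold deriv_coeff; simpl Cpow; ring).
    rewrite Cmod_mult. unfold M.
    apply Rmult_le_reg_l with rho; [lra|].
    rewrite <- Rmult_assoc.
    apply Rle_trans with (Cmod (w - z) ^ 2 * (INR (S n) ^ 2 * rho ^ n) *
      Cmod (u (S n))).
    + apply Rmult_le_compat_r; [apply Cmod_ge_0 | exact H5].
    + right; field; lra. }
rewrite (is_C_derive_unique _ _ _ Hd).
split; [exact Hd | apply is_pseries_Cpow, Hl].
Qed.

(** * Caratheodory's coefficient bound *)

Definition cos_sum (N : nat) (x : R) : R :=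
  sum_f_R0 (fun k => cos (INR k * x)) N.

Definition sin_sum (N : nat) (x : R) : R :=
  sum_f_R0 (fun k => sin (INR k * x)) N.

Lemma cos_sum_closed (N : nat) (x : R) :
  2 * sin (x / 2) * cos_sum N x = sin (INR (S N) * x - x / 2) + sin (x / 2).
Proof.
unfold cos_sum; induction N as [|N IH].
- simpl. rewrite Rmult_0_l, cos_0, Rmult_1_l.
  replace (x - x / 2) with (x / 2) by field. ring.
- rewrite tech5, Rmult_plus_distr_l, IH.
  rewrite (S_INR (S N)). set (y := INR (S N) * x).
  replace ((INR (S N) + 1) * x - x / 2) with (y + x / 2)
    by (unfold y; field).
  rewrite sin_plus, sin_minus. ring.
Qed.

Lemma sin_sum_closed (N : nat) (x : R) :
  2 * sin (x / 2) * sin_sum N x = cos (x / 2) - cos (INR (S N) * x - x / 2).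
Proof.
unfold sin_sum; induction N as [|N IH].
- simpl. rewrite Rmult_0_l, sin_0, Rmult_1_l.
  replace (x - x / 2) with (x / 2) by field. ring.
- rewrite tech5, Rmult_plus_distr_l, IH.
  rewrite (S_INR (S N)). set (y := INR (S N) * x).
  replace ((INR (S N) + 1) * x - x / 2) with (y + x / 2)
    by (unfold y; field).
  rewrite cos_plus, cos_minus. ring.
Qed.

(** A geometric sum over powers of exp (i x) vanishes when exp (i (N + 1) x) = 1 and exp (i x) <> 1;
    the last condition is sin (x / 2) <> 0. *)
Lemma roots_of_unity_sum (N : nat) (x : R) :
  cos (INR (S N) * x) = 1 -> sin (INR (S N) * x) = 0 -> sin (x / 2) <> 0 ->
  cos_sum N x = 0 /\ sin_sum N x = 0.
Proof.
intros Hc Hs Hx.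
pose proof (cos_sum_closed N x) as E1; pose proof (sin_sum_closed N x) as E2.
rewrite sin_minus, Hc, Hs in E1; rewrite cos_minus, Hc, Hs in E2.
split; apply Rmult_eq_reg_l with (2 * sin (x / 2)); lra.
Qed.

Lemma cos_sin_2PI_INR (k : nat) :
  cos (2 * PI * INR k) = 1 /\ sin (2 * PI * INR k) = 0.
Proof.
induction k as [|k [IH1 IH2]].
- simpl; rewrite Rmult_0_r, cos_0, sin_0; easy.
- rewrite S_INR. replace (2 * PI * (INR k + 1)) with (2 * PI * INR k + 2 * PI)
    by ring. rewrite cos_plus, sin_plus, IH1, IH2, cos_2PI, sin_2PI.
  split; ring.
Qed.

Definition unity_angle (N : nat) : R := 2 * PI / INR (S N).

(** The frequency j is real so as to cover differences m - n of either sign; the two trigonometric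
    conditions say that it is an integer. The sine in question is taken at PI j / (N + 1), of
    modulus strictly between 0 and PI. *)
Lemma unity_angle_sum (N : nat) (j : R) :
  0 < Rabs j < INR (S N) ->
  cos (2 * PI * j) = 1 -> sin (2 * PI * j) = 0 ->
  cos_sum N (j * unity_angle N) = 0 /\ sin_sum N (j * unity_angle N) = 0.
Proof.
intros [Hj1 Hj2] Hc Hs.
pose proof (lt_0_INR (S N) ltac:(lia)) as HN. pose proof PI_RGT_0 as Hpi.
assert (E : INR (S N) * (j * unity_angle N) = 2 * PI * j)
  by (unfold unity_angle; field; lra).
apply roots_of_unity_sum; rewrite ?E; try easy.
assert (Hpos : forall i, 0 < i < INR (S N) ->
  0 < sin (i * unity_angle N / 2)).
{ intros i Hi. replace (i * unity_angle N / 2) with (PI * (i / INR (S N)))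
    by (unfold unity_angle; field; lra).
  assert (0 < i / INR (S N)) by (apply Rdiv_lt_0_compat; lra).
  assert (i / INR (S N) < 1).
  { apply Rmult_lt_reg_r with (INR (S N)); [exact HN|].
    unfold Rdiv; rewrite Rmult_assoc, Rinv_l by lra; lra. }
  apply sin_gt_0; nra. }
unfold Rabs in *; destruct (Rcase_abs j) as [Hneg|Hnn].
- specialize (Hpos (- j) ltac:(lra)).
  replace (- j * unity_angle N / 2) with (- (j * unity_angle N / 2)) in Hpos
    by field. rewrite sin_neg in Hpos; lra.
- specialize (Hpos j ltac:(lra)); lra.
Qed.

Lemma sum_f_R0_exchange (g : nat -> nat -> R) (M N : nat) :
  sum_f_R0 (fun k => sum_f_R0 (fun m => g m k) M) N =
  sum_f_R0 (fun m => sum_f_R0 (g m) N) M.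
Proof.
induction M as [|M IH]; [reflexivity|].
rewrite tech5, <- IH, <- plus_sum. reflexivity.
Qed.

Lemma sum_f_R0_single (M n : nat) (x : R) : (n <= M)%nat ->
  sum_f_R0 (fun m => if (m =? n)%nat then x else 0) M = x.
Proof.
intros H; induction H as [|M H IH].
- destruct n as [|n]; [reflexivity|].
  rewrite tech5, Nat.eqb_refl, (sum_eq _ (fun _ => 0)).
  + rewrite sum_cte; ring.
  + intros i Hi; rewrite (proj2 (Nat.eqb_neq _ _)) by lia; easy.
- rewrite tech5, IH, (proj2 (Nat.eqb_neq _ _)) by lia; ring.
Qed.

(* With Q = alpha + i beta and v = v1 + i v2, this averages
   Re (Q w^m) (1 + Re (v w^n)) over the roots of unity w of order N + 1. *)
Lemma trig_average (N m n : nat) (alpha beta v1 v2 : R) :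
  (0 < n)%nat -> (m + n < S N)%nat ->
  sum_f_R0 (fun k => let t := INR k * unity_angle N in
    (alpha * cos (INR m * t) - beta * sin (INR m * t)) *
    (1 + (v1 * cos (INR n * t) - v2 * sin (INR n * t)))) N =
  (if (m =? 0)%nat then INR (S N) * alpha else 0) +
  (if (m =? n)%nat then INR (S N) / 2 * (alpha * v1 + beta * v2) else 0).
Proof.
intros Hn HN. set (th := unity_angle N).
(* Product-to-sum formulas leave the frequencies m, m + n and m - n. All are below N + 1 in modulus,
   so only a zero frequency survives the summation. *)
transitivity (alpha * cos_sum N (INR m * th) - beta * sin_sum N (INR m * th) +
  / 2 * ((alpha * v1 - beta * v2) * cos_sum N ((INR m + INR n) * th)
    - (alpha * v2 + beta * v1) * sin_sum N ((INR m + INR n) * th)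
    + (alpha * v1 + beta * v2) * cos_sum N ((INR m - INR n) * th)
    + (alpha * v2 - beta * v1) * sin_sum N ((INR m - INR n) * th))).
{ unfold cos_sum, sin_sum. clearbody th; clear HN; induction N as [|K IH].
  - simpl. rewrite !Rmult_0_l, !Rmult_0_r, cos_0, sin_0; field.
  - rewrite !tech5, IH. cbv zeta. set (x := INR (S K)).
    replace (INR m * (x * th)) with (x * (INR m * th)) by ring.
    replace (INR n * (x * th)) with (x * (INR n * th)) by ring.
    replace (x * ((INR m + INR n) * th)) with
      (x * (INR m * th) + x * (INR n * th)) by ring.
    replace (x * ((INR m - INR n) * th)) with
      (x * (INR m * th) - x * (INR n * th)) by ring.
    rewrite cos_plus, sin_plus, cos_minus, sin_minus. field. }
assert (HNn : INR (m + n) < INR (S N)) by (apply lt_INR; lia).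
rewrite plus_INR in HNn.
pose proof (pos_INR m) as Hm0. pose proof (lt_0_INR n ltac:(lia)) as Hn0.
destruct (cos_sin_2PI_INR m) as [Cm Sm].
destruct (cos_sin_2PI_INR n) as [Cn Sn].
assert (Cz : cos_sum N (0 * th) = INR (S N)).
{ unfold cos_sum. rewrite (sum_eq _ (fun _ => 1)).
  - rewrite sum_cte; ring.
  - intros; rewrite Rmult_0_l, Rmult_0_r; apply cos_0. }
assert (Sz : sin_sum N (0 * th) = 0).
{ unfold sin_sum. rewrite (sum_eq _ (fun _ => 0)).
  - rewrite sum_cte; ring.
  - intros; rewrite Rmult_0_l, Rmult_0_r; apply sin_0. }
destruct (unity_angle_sum N (INR m + INR n)) as [E1 E2].
{ rewrite Rabs_pos_eq; lra. }
{ rewrite Rmult_plus_distr_l, cos_plus, Cm, Cn, Sm, Sn; ring. }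
{ rewrite Rmult_plus_distr_l, sin_plus, Cm, Cn, Sm, Sn; ring. }
fold th in E1, E2; rewrite E1, E2.
assert (E34 : cos_sum N ((INR m - INR n) * th) =
    (if (m =? n)%nat then INR (S N) else 0) /\
  sin_sum N ((INR m - INR n) * th) = 0).
{ destruct (Nat.eqb_spec m n) as [->|Hmn].
  - rewrite Rminus_diag; easy.
  - apply unity_angle_sum.
    + split.
      * apply Rabs_pos_lt. apply not_INR in Hmn; lra.
      * apply Rabs_def1; lra.
    + rewrite Rmult_minus_distr_l, cos_minus, Cm, Cn, Sm, Sn; ring.
    + rewrite Rmult_minus_distr_l, sin_minus, Cm, Cn, Sm, Sn; ring. }
assert (E56 : cos_sum N (INR m * th) =
    (if (m =? 0)%nat then INR (S N) else 0) /\ sin_sum N (INR m * th) = 0).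
{ destruct (Nat.eqb_spec m 0) as [->|Hmn]; [easy|].
  pose proof (lt_0_INR m ltac:(lia)).
  apply unity_angle_sum; [rewrite Rabs_pos_eq; lra | easy | easy]. }
destruct E34 as [-> ->]; destruct E56 as [-> ->].
destruct (m =? n)%nat, (m =? 0)%nat; field.
Qed.

(** Average the nonnegative real part against the nonnegative weight 1 + Re (v w^n): only the
    frequencies 0 and n survive, giving alpha_0 + r^n X / 2. Then r tends to 1. *)
Lemma caratheodory_real (alpha beta : nat -> R) (n : nat) (v1 v2 : R) :
  (0 < n)%nat -> v1 ^ 2 + v2 ^ 2 = 1 ->
  (forall r, 0 < r < 1 ->
    ex_series (fun m => (Rabs (alpha m) + Rabs (beta m)) * r ^ m)) ->
  (forall r t, 0 < r < 1 -> 0 <= Series (fun m =>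
    r ^ m * (alpha m * cos (INR m * t) - beta m * sin (INR m * t)))) ->
  0 <= 2 * alpha O + (alpha n * v1 + beta n * v2).
Proof.
intros Hn Hv Hex Hpos.
set (X := alpha n * v1 + beta n * v2).
assert (Hr : forall r, 0 < r < 1 -> 0 <= 2 * alpha O + r ^ n * X).
{ intros r Hr. specialize (Hex r Hr).
  set (Mj := fun m => (Rabs (alpha m) + Rabs (beta m)) * r ^ m) in *.
  apply le_epsilon; intros e He.
  assert (HT : exists M, (n <= M)%nat /\
    Series (fun k => Mj (S M + k)%nat) < e / 2).
  { destruct Hex as [s Hs]. pose proof (proj1 (is_series_iff_lim _ _) Hs) as H.
    apply is_lim_seq_spec in H.
    destruct (H (mkposreal (e / 2) ltac:(lra))) as [M HM]; simpl in HM.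
    exists (M + n)%nat; split; [lia|].
    specialize (HM (M + n)%nat ltac:(lia)).
    pose proof (Series_split Mj (M + n) (ex_intro _ _ Hs)) as E.
    rewrite (is_series_unique _ _ Hs) in E. apply Rabs_def2 in HM; lra. }
  destruct HT as (M & HnM & HT).
  (* With N + 1 nodes no frequency m + n with m <= M is aliased to 0. The cut at [M] costs at most e
     / 2, which becomes e after doubling. *)
  set (N := (M + n)%nat).
  set (p := fun m t =>
    r ^ m * (alpha m * cos (INR m * t) - beta m * sin (INR m * t))).
  set (wt := fun t => 1 + (v1 * cos (INR n * t) - v2 * sin (INR n * t))).
  assert (Hp : forall t m, Rabs (p m t) <= Mj m).
  { intros t m; unfold p, Mj.
    pose proof (pow_lt r m (proj1 Hr)) as Hrm.
    rewrite Rabs_mult, (Rabs_pos_eq (r ^ m)), Rmult_comm by lra.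
    apply Rmult_le_compat_r; [lra|].
    apply Rle_trans with (1 := Rabs_triang _ _).
    rewrite Rabs_Ropp, !Rabs_mult.
    pose proof (Rabs_pos (alpha m)); pose proof (Rabs_pos (beta m)).
    assert (Rabs (cos (INR m * t)) <= 1)
      by (apply Rabs_le; apply COS_bound).
    assert (Rabs (sin (INR m * t)) <= 1)
      by (apply Rabs_le; apply SIN_bound).
    pose proof (Rabs_pos (cos (INR m * t))).
    pose proof (Rabs_pos (sin (INR m * t))). nra. }
  assert (Hlow : forall t, - (e / 2) <= sum_f_R0 (fun m => p m t) M).
  { intros t; pose proof (Hpos r t Hr) as H.
    rewrite (Series_split _ M) in H
      by (apply ex_series_dominated with (2 := Hex), Hp).
    pose proof (Series_dominated (fun k => p (S M + k)%nat t)
      (fun k => Mj (S M + k)%nat) (fun k => Hp t _)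
      (proj1 (ex_series_incr_n Mj (S M)) Hex)) as H1.
    apply Rabs_le_between in H1. unfold p in *; lra. }
  assert (Hwt : forall t, 0 <= wt t).
  { intros t; unfold wt. pose proof (sin2_cos2 (INR n * t)) as H.
    unfold Rsqr in H. set (co := cos _) in *; set (si := sin _) in *.
    assert ((v1 * co - v2 * si) ^ 2 <= 1).
    { replace ((v1 * co - v2 * si) ^ 2) with
        ((v1 ^ 2 + v2 ^ 2) * (si * si + co * co) - (v1 * si + v2 * co) ^ 2)
        by ring. rewrite Hv, H. pose proof (pow2_ge_0 (v1 * si + v2 * co)).
      lra. }
    nra. }
  assert (Hw1 : sum_f_R0 (fun k => wt (INR k * unity_angle N)) N = INR (S N)).
  { pose proof (trig_average N 0 n 1 0 v1 v2 Hn ltac:(unfold N; lia)) as E.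
    rewrite (proj2 (Nat.eqb_neq 0 n)) in E by lia. simpl Nat.eqb in E.
    cbv iota in E. rewrite Rmult_1_r, Rplus_0_r in E. rewrite <- E.
    apply sum_eq; intros k _; cbv zeta; unfold wt.
    simpl (INR 0); rewrite Rmult_0_l, cos_0; ring. }
  assert (Havg : - (e / 2) * INR (S N) <= sum_f_R0 (fun k =>
    sum_f_R0 (fun m => p m (INR k * unity_angle N) *
      wt (INR k * unity_angle N)) M) N).
  { rewrite <- Hw1, Rmult_comm, (Rmult_comm (sum_f_R0 _ _)), scal_sum.
    apply sum_Rle; intros k _. set (t := INR k * unity_angle N).
    replace (sum_f_R0 (fun m => p m t * wt t) M) with
      (sum_f_R0 (fun m => p m t) M * wt t)
      by (rewrite Rmult_comm, scal_sum; reflexivity).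
    rewrite Rmult_comm; apply Rmult_le_compat_r; [apply Hwt | apply Hlow]. }
  rewrite (sum_f_R0_exchange (fun m k => p m (INR k * unity_angle N) *
    wt (INR k * unity_angle N))) in Havg.
  assert (E : forall m, (m <= M)%nat ->
    sum_f_R0 (fun k => p m (INR k * unity_angle N) *
      wt (INR k * unity_angle N)) N =
    (if (m =? 0)%nat then INR (S N) * alpha O else 0) +
    (if (m =? n)%nat then INR (S N) / 2 * (r ^ n * X) else 0)).
  { intros m Hm.
    transitivity (r ^ m * ((if (m =? 0)%nat then INR (S N) * alpha m else 0) +
     (if (m =? n)%nat then INR (S N) / 2 * (alpha m * v1 + beta m * v2)
      else 0))).
    - rewrite <- (trig_average N m n (alpha m) (beta m) v1 v2 Hn)
        by (unfold N; lia).
      rewrite scal_sum; apply sum_eq; intros k _; unfold p, wt; ring.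
    - unfold X; destruct (Nat.eqb_spec m n) as [->|_];
        [|destruct (Nat.eqb_spec m 0) as [->|_]; simpl; ring].
      rewrite (proj2 (Nat.eqb_neq n 0)) by lia; ring. }
  rewrite (sum_eq _ _ M E), plus_sum, !sum_f_R0_single in Havg by lia.
  pose proof (lt_0_INR (S N) ltac:(lia)) as HN0.
  apply Rmult_le_reg_l with (INR (S N)); [exact HN0|]. lra. }
rewrite <- (Rmult_1_l X), <- (pow1 n).
apply (is_lim_seq_le (fun _ => 0)
  (fun k => 2 * alpha O + (1 - / (2 + INR k)) ^ n * X) 0
  (2 * alpha O + 1 ^ n * X)).
- intros k; apply Hr. pose proof (pos_INR k).
  assert (0 < / (2 + INR k)) by (apply Rinv_0_lt_compat; lra).
  assert (/ (2 + INR k) < 1)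
    by (rewrite <- Rinv_1; apply Rinv_lt_contravar; lra). lra.
- apply is_lim_seq_const.
- apply is_lim_seq_plus'; [apply is_lim_seq_const|].
  apply is_lim_seq_mult'; [|apply is_lim_seq_const].
  assert (Hlim : is_lim_seq (fun k => 1 - / (2 + INR k)) 1).
  { replace (Finite 1) with (Finite (1 - 0)) by (f_equal; ring).
    apply is_lim_seq_minus'; [apply is_lim_seq_const|].
    apply is_lim_seq_inv_INR; lra. }
  clear - Hlim; induction n as [|n IH]; simpl; [apply is_lim_seq_const|].
  apply is_lim_seq_mult'; easy.
Qed.

(** * The integral operator *)

Definition polar (r t : R) : C := (r * cos t, r * sin t).

Lemma de_Moivre (r t : R) (m : nat) :
  (polar r t ^ m)%C
  = polar (r ^ m) (INR m * t).
Proof.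
induction m as [|m IH].
- unfold polar; simpl; rewrite Rmult_0_l, cos_0, sin_0.
  unfold RtoC; f_equal; ring.
- change (polar r t ^ S m)%C with
    (polar r t * polar r t ^ m)%C.
  rewrite IH, S_INR; unfold polar.
  replace ((INR m + 1) * t) with (t + INR m * t) by ring.
  rewrite cos_plus, sin_plus. unfold Cmult; simpl; f_equal; ring.
Qed.

Lemma Cmod_polar (r t : R) : 0 <= r -> Cmod (polar r t) = r.
Proof.
intros Hr; unfold Cmod; simpl fst; simpl snd.
pose proof (sin2_cos2 t) as H; unfold Rsqr in H.
replace ((r * cos t) ^ 2 + (r * sin t) ^ 2) with
  (r * r * (sin t * sin t + cos t * cos t)) by ring.
rewrite H, Rmult_1_r; apply sqrt_square, Hr.
Qed.

Lemma expands_as_C_derive (f : C -> C) (u : nat -> C) :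
  expands_as f u -> expands_as (C_derive f) (deriv_coeff u).
Proof. intros Hf z Hz; apply (expands_as_derive f u z Hf Hz). Qed.

Lemma unit_disk_0 : unit_disk 0.
Proof. unfold unit_disk; rewrite Cmod_0; lra. Qed.

Lemma expands_as_0 (f : C -> C) (u : nat -> C) : expands_as f u -> f 0 = u O.
Proof.
intros Hf. specialize (Hf 0 unit_disk_0).
exact (filterlim_locally_unique _ _ _ Hf
  (is_pseries_0 (K := C_AbsRing) (V := C_NormedModule) u)).
Qed.

Lemma expands_as_C_derive_0 (f : C -> C) (u : nat -> C) :
  expands_as f u -> C_derive f 0 = u 1%nat.
Proof.
intros Hf. rewrite (expands_as_0 _ _ (expands_as_C_derive f u Hf)).
unfold deriv_coeff; simpl; ring.
Qed.

(** [clausen_operator] brings its own expansion of f; its first two coefficients are f(0) and f'(0),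
    hence the normalized ones. *)
Lemma class_A_coeff (f : C -> C) (u : nat -> C) :
  class_A f -> expands_as f u -> u O = 0 /\ u 1%nat = 1.
Proof.
intros [_ (u' & H0 & H1 & Hu')] Hu.
rewrite <- (expands_as_0 _ _ Hu), <- (expands_as_C_derive_0 _ _ Hu).
rewrite (expands_as_0 _ _ Hu'), (expands_as_C_derive_0 _ _ Hu'); easy.
Qed.

Lemma Rabs_Re_Im_le (q : C) : Rabs (Re q) + Rabs (Im q) <= 2 * Cmod q.
Proof.
pose proof (Rmax_Cmod q) as H.
pose proof (Rmax_l (Rabs (fst q)) (Rabs (snd q))).
pose proof (Rmax_r (Rabs (fst q)) (Rabs (snd q))).
unfold Re, Im; lra.
Qed.

Lemma caratheodory (p : C -> C) (q : nat -> C) (n : nat) :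
  expands_as p q -> (forall z, unit_disk z -> 0 <= Re (p z)) ->
  (0 < n)%nat -> Cmod (q n) <= 2 * Re (q O).
Proof.
intros Hp Hpos Hn.
assert (H : forall v1 v2, v1 ^ 2 + v2 ^ 2 = 1 ->
  0 <= 2 * Re (q O) + (Re (q n) * v1 + Im (q n) * v2)).
{ intros v1 v2 Hv.
  apply (caratheodory_real (fun m => Re (q m)) (fun m => Im (q m)) n v1 v2 Hn Hv).
  - intros r Hr. pose proof (disk_coeff_summable p q r Hp ltac:(lra)) as Hs.
    apply ex_series_dominated with
      (2 := ex_series_Rmult 2 _ Hs).
    intros m. pose proof (Rabs_Re_Im_le (q m)) as H1.
    pose proof (Rabs_pos (Re (q m))); pose proof (Rabs_pos (Im (q m))).
    pose proof (pow_lt r m (proj1 Hr)) as Hrm.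
    rewrite Rabs_pos_eq by (apply Rmult_le_pos; lra).
    apply Rle_trans with (2 * Cmod (q m) * r ^ m);
      [apply Rmult_le_compat_r; lra|].
    pose proof (Rmult_le_pos _ _ (Cmod_ge_0 (q m)) (Rlt_le _ _ Hrm)).
    assert (1 <= INR (S m) ^ 2).
    { rewrite <- Rsqr_pow2; unfold Rsqr; rewrite S_INR.
      pose proof (pos_INR m); nra. }
    nra.
  - intros r t Hr.
    assert (Hz : unit_disk (polar r t))
      by (unfold unit_disk; rewrite Cmod_polar; lra).
    pose proof (proj1 (is_pseries_Cpow _ _ _) (Hp _ Hz)) as Hs.
    apply is_series_Re, is_series_unique in Hs.
    specialize (Hpos _ Hz). rewrite <- Hs in Hpos.
    apply Rle_trans with (1 := Hpos); right; apply Series_ext; intros m.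
    rewrite de_Moivre. unfold polar, Re, Im; simpl; ring. }
destruct (Req_dec (Cmod (q n)) 0) as [H0|H0].
- pose proof (H 1 0 ltac:(ring)) as H1. pose proof (H (-1) 0 ltac:(ring)).
  apply Cmod_eq_0 in H0; rewrite H0 in *. rewrite Cmod_0. simpl in *; lra.
- set (d := Cmod (q n)) in *.
  assert (Hd : Re (q n) ^ 2 + Im (q n) ^ 2 = d ^ 2)
    by (symmetry; apply Cmod2_alt).
  (* The unit vector opposite to q_n, which makes the linear form equal to - |q_n|. *)
  specialize (H (- Re (q n) / d) (- Im (q n) / d)).
  replace (Re (q n) * (- Re (q n) / d) + Im (q n) * (- Im (q n) / d)) with (- d)
    in H.
  + enough (0 <= 2 * Re (q O) + - d) by lra. apply H.
    replace ((- Re (q n) / d) ^ 2 + (- Im (q n) / d) ^ 2) with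
      ((Re (q n) ^ 2 + Im (q n) ^ 2) / d ^ 2) by (field; exact H0).
    rewrite Hd; field; exact H0.
  + transitivity (- (Re (q n) ^ 2 + Im (q n) ^ 2) / d);
      [rewrite Hd|]; field; exact H0.
Qed.

(** Caratheodory's bound for exp (i phi) (f' - beta). Its coefficient of index n > 0 has modulus (n
    + 1) |u_(n+1)|, and its constant term has real part (1 - beta) cos phi. *)
Lemma class_R_coeff (beta : R) (f : C -> C) (u : nat -> C) (n : nat) :
  beta < 1 -> class_R beta f -> expands_as f u -> (0 < n)%nat ->
  INR (S n) * Cmod (u (S n)) <= 2 * (1 - beta).
Proof.
intros Hb [HA [phi Hphi]] Hu Hn.
destruct (class_A_coeff f u HA Hu) as [_ H1].
set (w := (cos phi, sin phi)) in *.
set (q := fun m => (w * (deriv_coeff u m -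
  (if (m =? 0)%nat then RtoC beta else RtoC 0)))%C).
assert (Hw : Cmod w = 1).
{ unfold w; rewrite <- (Rmult_1_l (cos phi)), <- (Rmult_1_l (sin phi)).
  apply Cmod_polar; lra. }
assert (Hq : expands_as (fun z => (w * (C_derive f z - beta))%C) q).
{ intros z Hz. apply is_pseries_Cpow.
  pose proof (proj1 (is_pseries_Cpow _ _ _) (expands_as_C_derive f u Hu z Hz))
    as Hd.
  assert (Hc : is_series (fun m =>
    (z ^ m * (if (m =? 0)%nat then RtoC beta else RtoC 0))%C) (RtoC beta)).
  { apply is_pseries_Cpow. apply is_series_C_iff; intros e He.
    exists O; intros m _.
    replace (sum_n _ m) with (RtoC beta).
    - replace (RtoC beta - RtoC beta)%C with (RtoC 0) by ring.
      rewrite Cmod_0; exact He.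
    - induction m as [|m IH].
      + rewrite sum_O. symmetry; exact (Cmult_1_l beta).
      + rewrite sum_Sn, <- IH.
        change (RtoC beta = RtoC beta + pow_n z (S m) * RtoC 0)%C. ring. }
  apply is_Cseries_ext with (2 :=
    is_Cseries_scal w _ _ (is_Cseries_minus _ _ _ _ Hd Hc)).
  intros m; unfold q; ring. }
assert (Hqn : Cmod (q n) = INR (S n) * Cmod (u (S n))).
{ unfold q, deriv_coeff. rewrite (proj2 (Nat.eqb_neq n 0)) by lia.
  rewrite Cmod_mult, Hw.
  replace (INR (S n) * u (S n) - 0)%C with (INR (S n) * u (S n))%C by ring.
  rewrite Cmod_mult, Cmod_RtoC by apply pos_INR. ring. }
rewrite <- Hqn.
apply Rle_trans with (1 := caratheodory _ q n Hq
  (fun z Hz => Rlt_le _ _ (Hphi z Hz)) Hn).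
assert (Hq0 : Re (q O) = (1 - beta) * cos phi).
{ unfold q, deriv_coeff; simpl Nat.eqb; cbv iota. rewrite H1.
  unfold w, Re; simpl; ring. }
rewrite Hq0. pose proof (COS_bound phi); nra.
Qed.

(** * Pochhammer symbols and the size of the operator's coefficients *)

Lemma pochhammer_RtoC (x : R) (n : nat) :
  pochhammer (RtoC x) n = RtoC (rising x n).
Proof.
induction n as [|n IH]; [reflexivity|]. simpl.
rewrite IH, <- RtoC_plus, <- RtoC_mult; reflexivity.
Qed.

Lemma rising_1_fact (n : nat) : rising 1 n = INR (fact n).
Proof.
induction n as [|n IH]; [reflexivity|].
rewrite fact_simpl, mult_INR; simpl rising. rewrite IH, S_INR; ring.
Qed.

Lemma pochhammer_mod_le (x : C) (n : nat) :
  Cmod (pochhammer x n) <= rising (Cmod x) n.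
Proof.
induction n as [|n IH]; [simpl; rewrite Cmod_1; lra|]. simpl.
rewrite Cmod_mult. apply Rmult_le_compat; try apply Cmod_ge_0; [exact IH|].
apply Rle_trans with (1 := Cmod_triangle _ _).
rewrite Cmod_RtoC by apply pos_INR; lra.
Qed.

Lemma pochhammer_S (x : C) (n : nat) :
  pochhammer x (S n) = (pochhammer x n * (x + INR n))%C.
Proof. reflexivity. Qed.

(** The factors of (x)_2m with even and odd index, each divided by 2, form the two symbols on the
    left. This is why half-parameters in the operator lead to weights of index 2 m. *)
Lemma pochhammer_duplication (x : C) (m : nat) :
  (RtoC 4 ^ m * (pochhammer (x / 2) m * pochhammer ((x + 1) / 2) m))%C
  = pochhammer x (m + m).
Proof.
induction m as [|m IH]; [simpl; ring|].
replace (S m + S m)%nat with (S (S (m + m))) by lia.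
rewrite !pochhammer_S, <- IH, S_INR, plus_INR, !RtoC_plus.
simpl Cpow. replace (RtoC 4) with (RtoC 2 * RtoC 2)%C
  by (rewrite <- RtoC_mult; f_equal; ring).
field.
Qed.

(** After duplication in b and in c the powers of 4 cancel; the numerator is estimated factor by
    factor, while the denominator is real and positive. *)
Lemma clausen_coeff_mod_le (a b : C) (c : R) (m : nat) : 0 < c ->
  Cmod (clausen_coeff a (b / 2) ((b + 1) / 2) (c / 2) ((c + 1) / 2) m)
  <= negbin (Cmod a) m * pochratio (Cmod b) c (m + m).
Proof.
intros Hc.
pose proof (rising_pos c (m + m) Hc) as Hr.
pose proof (INR_fact_lt_0 m) as Hf.
assert (H4 : (RtoC 4 ^ m)%C <> 0)
  by (apply Cpow_nz; intros H; apply RtoC_inj in H; lra).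
pose proof (pochhammer_duplication b m) as Eb.
pose proof (pochhammer_duplication (RtoC c) m) as Ec.
rewrite pochhammer_RtoC in Ec.
assert (Hc0 : RtoC (rising c (m + m)) <> 0)
  by (intros H; apply RtoC_inj in H; lra).
assert (Hf0 : RtoC (INR (fact m)) <> 0)
  by (intros H; apply RtoC_inj in H; lra).
unfold clausen_coeff.
rewrite (pochhammer_RtoC 1), rising_1_fact.
set (p1 := pochhammer (c / 2) m) in *.
set (p2 := pochhammer ((c + 1) / 2) m) in *.
assert (Hp1 : p1 <> 0) by (intros H; apply Hc0; rewrite <- Ec, H; ring).
assert (Hp2 : p2 <> 0) by (intros H; apply Hc0; rewrite <- Ec, H; ring).
replace (_ / _)%C with (pochhammer a m * pochhammer b (m + m) /
  (RtoC (rising c (m + m)) * RtoC (INR (fact m))))%C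
  by (rewrite <- Eb, <- Ec; field; easy).
rewrite <- RtoC_mult, Cmod_div
  by (intros H; apply RtoC_inj, Rmult_integral in H; lra).
rewrite Cmod_RtoC, Cmod_mult by (apply Rmult_le_pos; lra).
unfold negbin, pochratio.
replace (rising (Cmod a) m / INR (fact m) *
  (rising (Cmod b) (m + m) / rising c (m + m))) with
  (rising (Cmod a) m * rising (Cmod b) (m + m) /
   (rising c (m + m) * INR (fact m))) by (field; lra).
apply Rmult_le_compat_r.
- apply Rlt_le, Rinv_0_lt_compat, Rmult_lt_0_compat; easy.
- apply Rmult_le_compat; try apply Cmod_ge_0; apply pochhammer_mod_le.
Qed.

Lemma gauss_coeff_RtoC (A B c : R) (k : nat) : 0 < c ->
  gauss_coeff (RtoC A) (RtoC B) (RtoC c) k =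
  RtoC (negbin A k * (rising B k / rising c k)).
Proof.
intros Hc; unfold gauss_coeff, negbin.
pose proof (rising_pos c k Hc); pose proof (INR_fact_lt_0 k).
rewrite !pochhammer_RtoC, rising_1_fact, <- !RtoC_mult, <- RtoC_div
  by (apply Rgt_not_eq, Rmult_lt_0_compat; easy).
f_equal; field; lra.
Qed.

Lemma is_2F1_Abel (A B c : R) (F : C -> C) (r : nat -> R) :
  0 < c -> is_2F1 (RtoC A) (RtoC B) (RtoC c) F ->
  (forall n, 0 <= r n < 1) -> is_lim_seq r 1 ->
  is_lim_seq (fun n => hyper_series A B c (r n)) (Re (F (RtoC (-1)))).
Proof.
intros Hc [HF HF'] Hr Hr1.
assert (Hs : forall n, Re (F (RtoC (- r n))) = hyper_series A B c (r n)).
{ intros n. specialize (Hr n).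
  assert (Hz : unit_disk (RtoC (- r n))).
  { unfold unit_disk; rewrite Cmod_R, Rabs_Ropp, Rabs_pos_eq; lra. }
  pose proof (proj1 (is_pseries_Cpow _ _ _) (HF _ Hz)) as H.
  apply is_series_Re, is_series_unique in H. rewrite <- H.
  apply Series_ext; intros k.
  rewrite gauss_coeff_RtoC, <- RtoC_pow, <- RtoC_mult, re_RtoC by exact Hc.
  ring. }
apply is_lim_seq_ext with (1 := Hs).
assert (Hslit : slit_plane (RtoC (-1))).
{ unfold slit_plane; rewrite re_RtoC; lra. }
pose proof (ex_derive_continuous F (RtoC (-1)) (HF' _ Hslit)) as Hcont.
(* The continuity obtained from [ex_derive] puts the topology of [AbsRing_UniformSpace C_AbsRing] on
   the domain, so the convergence is stated there. *)
assert (Hlim : filterlim (fun n => RtoC (- r n)) eventually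
  (locally (T := AbsRing_UniformSpace C_AbsRing) (RtoC (-1)))).
{ intros P [e HP]. apply is_lim_seq_spec in Hr1. destruct (Hr1 e) as [N HN].
  exists N; intros n Hn; apply HP.
  change (Cmod (RtoC (- r n) - RtoC (-1)) < e).
  rewrite <- RtoC_minus, Cmod_R. specialize (HN n Hn).
  replace (- r n - -1) with (- (r n - 1)) by ring. rewrite Rabs_Ropp; easy. }
pose proof (filterlim_comp _ _ _ _ _ _ _ _ Hlim Hcont) as H.
apply is_lim_seq_spec; intros [e He]; simpl.
destruct (proj1 (C_filterlim_iff (fun n => F (RtoC (- r n))) _) H e He)
  as [N HN].
exists N; intros n Hn; apply Rle_lt_trans with (2 := HN n Hn).
apply Rle_trans with (2 := re_le_Cmod _). right; reflexivity.
Qed.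

(** With r = |z|, the tail sums give |z g' - g| <= r^2 X and |g| >= r - r^2 Y, where X + lambda Y <=
    lambda. Strictness and g z <> 0 both come from the margin lambda r (1 - r). *)
Lemma starlike_of_coeff (lambda : R) (g : C -> C) (b : nat -> C) :
  0 < lambda -> expands_as g b -> b O = 0 -> b 1%nat = 1 ->
  ex_series (fun m => (INR (S m) + lambda) * Cmod (b (S (S m)))) ->
  Series (fun m => (INR (S m) + lambda) * Cmod (b (S (S m)))) <= lambda ->
  starlike lambda g.
Proof.
intros Hl Hg Hb0 Hb1 Hex Hle.
split.
{ split; [|exists b; easy]. intros z Hz.
  eexists; apply (expands_as_derive g b z Hg Hz). }
set (s := fun m => Cmod (b (S (S m)))).
assert (Hs0 : forall m, 0 <= s m) by (intros; apply Cmod_ge_0).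
assert (HX : ex_series (fun m => INR (S m) * s m)).
{ apply ex_series_dominated with (2 := Hex); intros m; fold (s m).
  specialize (Hs0 m); pose proof (pos_INR (S m)).
  rewrite Rabs_pos_eq by (apply Rmult_le_pos; lra). nra. }
assert (HY : ex_series s).
{ apply ex_series_dominated with (2 := HX); intros m.
  specialize (Hs0 m); rewrite Rabs_pos_eq, S_INR by easy.
  pose proof (pos_INR m); nra. }
set (X := Series (fun m => INR (S m) * s m)) in *. set (Y := Series s) in *.
assert (HXY : X + lambda * Y <= lambda).
{ apply Rle_trans with (2 := Hle). unfold X, Y.
  rewrite <- Series_scal_l, <- Series_plus;
    [|exact HX | apply ex_series_Rmult, HY].
  right; apply Series_ext; intros m; unfold s; ring. }
assert (HX0 : 0 <= X).
{ apply Rle_trans with (sum_f_R0 (fun m => INR (S m) * s m) 0).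
  - specialize (Hs0 O); simpl; lra.
  - apply sum_le_Series; [|exact HX]. intros m; apply Rmult_le_pos;
      [apply pos_INR | apply Hs0]. }
intros z Hz Hz0. unfold unit_disk in Hz.
set (r := Cmod z) in *.
assert (Hr : 0 < r) by (apply Cmod_gt_0, Hz0).
pose proof (proj1 (is_pseries_Cpow _ _ _) (Hg z Hz)) as E0.
pose proof (proj1 (is_pseries_Cpow _ _ _) (expands_as_C_derive g b Hg z Hz))
  as E1.
pose proof (is_Cseries_tail _ _ E0) as E2.
assert (E3 : is_series (fun m => (z ^ S (S m) * b (S (S m)))%C) (g z - z)%C).
{ pose proof (is_Cseries_tail _ _ E2) as E. cbv beta in E.
  replace (g z - z ^ 0 * b O - z ^ 1 * b 1%nat)%C with (g z - z)%C in E
    by (rewrite Hb0, Hb1; simpl; ring). exact E. }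
assert (E4 : is_series
  (fun m => (z ^ S (S m) * (INR (S m) * b (S (S m))))%C)
  (z * C_derive g z - g z)%C).
{ pose proof (is_Cseries_minus _ _ _ _ (is_Cseries_scal z _ _ E1) E2) as E.
  apply is_Cseries_tail in E. cbv beta in E.
  replace (z * C_derive g z - (g z - z ^ 0 * b O) -
    (z * (z ^ 0 * deriv_coeff b 0) - z ^ 1 * b 1%nat))%C with
    (z * C_derive g z - g z)%C in E
    by (rewrite Hb0; unfold deriv_coeff; simpl; ring).
  apply is_Cseries_ext with (2 := E). intros m; unfold deriv_coeff.
  rewrite (S_INR (S m)), RtoC_plus; simpl Cpow; ring. }
assert (Hrm : forall m, r ^ S (S m) <= r ^ 2).
{ intros m. replace (r ^ S (S m)) with (r ^ 2 * r ^ m) by (simpl; ring).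
  rewrite <- (Rmult_1_r (r ^ 2)) at 2.
  apply Rmult_le_compat_l; [apply pow2_ge_0|].
  rewrite <- (pow1 m); apply pow_incr; lra. }
assert (B3 : Cmod (g z - z) <= r ^ 2 * Y).
{ unfold Y; rewrite <- Series_scal_l.
  apply (Cseries_mod_le _ _ _ E3); [|apply ex_series_Rmult, HY].
  intros m; rewrite Cmod_mult, Cmod_pow.
  apply Rmult_le_compat_r; [apply Hs0 | apply Hrm]. }
assert (B4 : Cmod (z * C_derive g z - g z) <= r ^ 2 * X).
{ unfold X; rewrite <- Series_scal_l.
  apply (Cseries_mod_le _ _ _ E4); [|apply ex_series_Rmult, HX].
  intros m; rewrite !Cmod_mult, Cmod_pow, Cmod_RtoC by apply pos_INR.
  apply Rmult_le_compat_r; [|apply Hrm].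
  apply Rmult_le_pos; [apply pos_INR | apply Hs0]. }
assert (B5 : r - r ^ 2 * Y <= Cmod (g z)).
{ enough (r <= Cmod (g z) + Cmod (g z - z)) by lra.
  rewrite <- (Cmod_opp (g z - z)). unfold r.
  replace z with (g z + - (g z - z))%C at 1 by ring. apply Cmod_triangle. }
(* The lower bound r - r^2 Y is split to expose the strict margin r (1 - r); the remaining part is
   matched with X <= lambda (1 - Y). *)
assert (HlY : lambda * (r * (1 - r) + r ^ 2 * (1 - Y)) <= lambda * Cmod (g z))
  by (apply Rmult_le_compat_l; [lra|]; lra).
assert (Hlt : Cmod (z * C_derive g z - g z) < lambda * Cmod (g z)).
{ apply Rle_lt_trans with (1 := B4). apply Rlt_le_trans with (2 := HlY).
  assert (0 < lambda * (r * (1 - r)))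
    by (apply Rmult_lt_0_compat; [|apply Rmult_lt_0_compat]; lra).
  assert (r ^ 2 * X <= r ^ 2 * (lambda * (1 - Y)))
    by (apply Rmult_le_compat_l; [apply pow2_ge_0 | lra]).
  lra. }
pose proof (Cmod_ge_0 (z * C_derive g z - g z)) as Hge.
assert (Hg0 : g z <> 0).
{ intros H; rewrite H, Cmod_0, Rmult_0_r in Hlt. rewrite H in Hge; lra. }
split; [exact Hg0|].
replace (z * C_derive g z / g z - 1)%C with ((z * C_derive g z - g z) / g z)%C
  by (field; exact Hg0).
rewrite Cmod_div by exact Hg0.
pose proof (proj1 (Cmod_gt_0 _) Hg0) as Hgp.
apply Rmult_lt_reg_r with (1 := Hgp).
unfold Rdiv; rewrite Rmult_assoc, Rinv_l, Rmult_1_r by lra. exact Hlt.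
Qed.

(** [maps_into] also asks for an image, so the sum function is built; [iota] selects the unique sum
    at each point of the disk. *)
Lemma expands_as_exists (b : nat -> C) :
  ex_series (fun n => Cmod (b n)) -> exists g, expands_as g b.
Proof.
intros Hb.
exists (fun z => iota (fun l : C_CompleteNormedModule => is_pseries b z l)).
intros z Hz. unfold unit_disk in Hz.
apply (iota_correct (V := C_CompleteNormedModule)).
destruct (ex_Cseries_dominated (fun n => (z ^ n * b n)%C)
  (fun n => Cmod (b n))) as [l Hl]; [|exact Hb|].
- intros n; rewrite Cmod_mult, Cmod_pow.
  rewrite <- (Rmult_1_l (Cmod (b n))) at 2.
  apply Rmult_le_compat_r; [apply Cmod_ge_0|].
  rewrite <- (pow1 n); apply pow_incr; split; [apply Cmod_ge_0 | lra].
- exists l; split; [apply is_pseries_Cpow, Hl|].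
  intros l' Hl'; apply is_pseries_Cpow in Hl'.
  exact (is_Cseries_unique _ _ _ Hl Hl').
Qed.

Theorem theorem2p3 (a b : C) (c lambda beta : R) (F1 F2 : C -> C)
  (ha0 : a <> 0) (hb0 : b <> 0) (hc0 : 0 < c)
  (ha1 : Cmod a <> 1) (hb1 : Cmod b <> 1) (hb2 : Cmod b <> 2)
  (hc : Rmax (Cmod a + 1) (Cmod a + Cmod b - 1) < c)
  (* Gamma (c - |a| - |b|) is defined *)
  (hGamma : 0 < c - Cmod a - Cmod b)
  (hlambda : 0 < lambda <= 1) (hbeta : 0 <= beta < 1)
  (hF1 : is_2F1 (Cmod a - 1) (Cmod b - 2) (c - Cmod a - 1) F1)
  (hF2 : is_2F1 (Cmod a) (Cmod b) (c - Cmod a) F2)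
  (hineq :
    Gamma c * Gamma (c - Cmod a - Cmod b) /
      (Gamma (c - Cmod a) * Gamma (c - Cmod b)) *
      ((lambda - 1) * (c - Cmod a - Cmod b) * (c - Cmod a - 1) /
         ((Cmod a - 1) * (Cmod b - 1) * (Cmod b - 2)) * Re (F1 (-1))
       + Re (F2 (-1)))
    <= lambda * (1 + 1 / (2 * (1 - beta)))
       + (lambda - 1) * (c - 1) * (c - 2) /
         ((Cmod a - 1) * (Cmod b - 1) * (Cmod b - 2))) :
  maps_into
    (clausen_operator a (b / 2)%C ((b + 1) / 2)%C (c / 2)%C ((c + 1) / 2)%C)
    (class_R beta) (starlike lambda).
Proof.
set (A := Cmod a) in *. set (B := Cmod b) in *.
assert (HA : 0 < A) by (apply Cmod_gt_0, ha0).
assert (HB : 0 < B) by (apply Cmod_gt_0, hb0).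
assert (HcA : A + 1 < c) by (apply Rle_lt_trans with (2 := hc), Rmax_l).
set (r := fun n => 1 - / (2 + INR n)).
assert (Hr : forall n, 0 <= r n < 1).
{ intros n; unfold r; pose proof (pos_INR n).
  assert (0 < / (2 + INR n)) by (apply Rinv_0_lt_compat; lra).
  assert (/ (2 + INR n) < 1)
    by (rewrite <- Rinv_1; apply Rinv_lt_contravar; lra). lra. }
assert (Hr1 : is_lim_seq r 1).
{ replace (Finite 1) with (Finite (1 - 0)) by (f_equal; ring).
  apply is_lim_seq_minus'; [apply is_lim_seq_const|].
  apply is_lim_seq_inv_INR; lra. }
(* The parameters are complex differences of coerced reals; they are turned into coercions of real
   differences. *)
change (is_2F1 A B (RtoC c - RtoC A)%C F2) in hF2.
change (is_2F1 (RtoC A - RtoC 1)%C (RtoC B - RtoC 2)%C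
  (RtoC c - RtoC A - RtoC 1)%C F1) in hF1.
rewrite <- RtoC_minus in hF2.
rewrite <- (RtoC_minus c A), <- !RtoC_minus in hF1.
pose proof (is_2F1_Abel (A - 1) (B - 2) (c - A - 1) F1 r ltac:(lra)
  hF1 Hr Hr1) as L1.
pose proof (is_2F1_Abel A B (c - A) F2 r ltac:(lra) hF2 Hr Hr1) as L2.
destruct (clausen_weighted_le A B c lambda _ _ _ r HA HB ltac:(lra) HcA
  ha1 hb1 hb2 Hr Hr1 L1 L2 hineq) as [Hex Hle].
clear L1 L2 hineq hF1 hF2 Hr Hr1.
set (T := fun m => (1 + (lambda - 1) * / INR (S m)) *
  (negbin A m * pochratio B c (m + m))) in *.
set (k := shifted_clausen_coeff a (b / 2) ((b + 1) / 2) (c / 2) ((c + 1) / 2)).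
assert (HexT : ex_series (fun m => T (S m)))
  by (apply (ex_series_incr_1 T), Hex).
(* The term of index 0 accounts for the summand 1 in 1 + 1 / (2 (1 - beta)); the others sum to at
   most lambda / (2 (1 - beta)). *)
assert (HT0 : T O = lambda).
{ unfold T, pochratio; rewrite negbin_0; simpl; field. }
assert (HTle : Series (fun m => 2 * (1 - beta) * T (S m)) <= lambda).
{ rewrite Series_scal_l. rewrite (Series_incr_1 T Hex), HT0 in Hle.
  assert (H : Series (fun m => T (S m)) <= lambda * (1 / (2 * (1 - beta))))
    by lra.
  apply (Rmult_le_compat_l (2 * (1 - beta))) in H; [|lra].
  replace (2 * (1 - beta) * (lambda * (1 / (2 * (1 - beta))))) with lambda in H
    by (field; lra). exact H. }
(* With n = m + 2, the bound |u_n| <= 2 (1 - beta) / n turns the weight n - 1 + lambda into 2 (1 -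
   beta) (1 + (lambda - 1) / n), the factor in T_(m+1). *)
assert (Hbound : forall f u m, class_R beta f -> expands_as f u ->
  (INR (S m) + lambda) * Cmod (k (S (S m)) * u (S (S m)))
  <= 2 * (1 - beta) * T (S m)).
{ intros f u m Hf Hu.
  pose proof (class_R_coeff beta f u (S m) (proj2 hbeta) Hf Hu ltac:(lia)) as H1.
  pose proof (clausen_coeff_mod_le a b c (S m) hc0) as H2.
  fold A B in H2. rewrite Cmod_mult.
  change (k (S (S m))) with (clausen_coeff a (b / 2) ((b + 1) / 2)
    (c / 2) ((c + 1) / 2) (S m)).
  set (kk := Cmod (clausen_coeff _ _ _ _ _ _)) in *.
  set (t := negbin A (S m) * pochratio B c (S m + S m)) in *.
  unfold T; fold t.
  pose proof (lt_0_INR (S (S m)) ltac:(lia)) as Hm2.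
  pose proof (pos_INR (S m)) as Hm1.
  replace (2 * (1 - beta) * ((1 + (lambda - 1) * / INR (S (S m))) * t)) with
    ((INR (S m) + lambda) * (t * (2 * (1 - beta) / INR (S (S m)))))
    by (rewrite (S_INR (S m)) in *; field; lra).
  apply Rmult_le_compat_l; [lra|].
  apply Rmult_le_compat; [apply Cmod_ge_0 .. | exact H2 |].
  apply Rmult_le_reg_l with (1 := Hm2).
  replace (INR (S (S m)) * (2 * (1 - beta) / INR (S (S m)))) with
    (2 * (1 - beta)) by (field; lra). exact H1. }
assert (Hk1 : k 1%nat = 1).
{ unfold k; simpl; unfold clausen_coeff; simpl; field. }
assert (Hsum : forall f u, class_R beta f -> expands_as f u ->
  ex_series (fun m => (INR (S m) + lambda) *
    Cmod (k (S (S m)) * u (S (S m))))).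
{ intros f u Hf Hu. apply ex_series_dominated with
    (2 := ex_series_Rmult (2 * (1 - beta)) _ HexT).
  intros m; rewrite Rabs_pos_eq; [apply (Hbound f u m Hf Hu)|].
  apply Rmult_le_pos; [pose proof (pos_INR (S m)); lra | apply Cmod_ge_0]. }
intros f Hf. split.
- destruct Hf as [HfA Hphi]; pose proof HfA as [_ (u & _ & _ & Hu)].
  destruct (expands_as_exists (fun n => (k n * u n)%C)) as [g Hg].
  (* The weights n - 1 + lambda are at least 1 from n = 2 on, so weighted summability implies plain
     summability. *)
  + apply (ex_series_incr_n _ 2).
    apply ex_series_dominated with
      (2 := Hsum f u (conj HfA Hphi) Hu).
    intros m; cbv beta. change (2 + m)%nat with (S (S m)).
    rewrite Rabs_pos_eq by apply Cmod_ge_0.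
    rewrite <- (Rmult_1_l (Cmod _)) at 1.
    apply Rmult_le_compat_r; [apply Cmod_ge_0|].
    rewrite S_INR; pose proof (pos_INR m); lra.
  + exists g, u; easy.
- intros g (u & Hu & Hg).
  destruct (class_A_coeff f u (proj1 Hf) Hu) as [Hu0 Hu1].
  apply (starlike_of_coeff lambda g _ (proj1 hlambda) Hg).
  + rewrite Hu0; ring.
  + fold k; rewrite Hu1, Hk1; ring.
  + apply (Hsum f u Hf Hu).
  + apply Rle_trans with (2 := HTle). apply Series_le.
    * intros m; split; [|apply (Hbound f u m Hf Hu)].
      apply Rmult_le_pos; [pose proof (pos_INR (S m)); lra | apply Cmod_ge_0].
    * apply ex_series_Rmult, HexT.
Qed.
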